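(* Let $n\geq 3$ and $m\geq 3$ be integers. Let $\Gamma$ be a graph with diameter $D\geq 2$ in which the following intersection numbers are well-defined with the values \[ b_0=nm,\quad b_1=(n-1)(m-1),\quad b_2=(n-3)(m-3),\quad c_2=6, \] and such that, for every vertex $x$ of $\Gamma$, the local graph $\Gamma(x)$ is isomorphic to the $(n\times m)$-grid. Then there exist natural numbers $d$ and $e$ such that $\min(m,n)=2^d-1$, $\max(m,n)=2^e-1$, and $\Gamma$ is covered by the bilinear forms graph $Bil_2(d\times e)$.
   Context: All graphs are finite, undirected and simple; $\Gamma$ is connected. For integers $e\geq d\geq 2$, the bilinear forms graph $Bil_2(d\times e)$ has as vertices all $(d\times e)$-matrices over $\mathbb{F}_2$, two matrices being adjacent if and only if the rank of their difference equals $1$. The $(n\times m)$-grid is the Cartesian product of the complete graphs on $n$ and $m$ vertices. Let $\partial$ denote the path-length distance and $\Gamma_i(x)$ the set of vertices at distance exactly $i$ from $x$, $\Gamma(x)=\Gamma_1(x)$ (with $\Gamma_{D+1}(x)=\emptyset$); the local graph of $x$ is the subgraph induced on $\Gamma(x)$. For $x,y$ with $\partial(x,y)=i$ put $c_i(x,y)=|\Gamma(y)\cap\Gamma_{i-1}(x)|$ and $b_i(x,y)=|\Gamma(y)\cap\Gamma_{i+1}(x)|$. The intersection number $c_i$ (resp. $b_i$) is well-defined if $c_i(x,y)$ (resp. $b_i(x,y)$) is the same for all pairs $x,y$ at distance $i$, and then $c_i$ (resp. $b_i$) denotes this common value. A covering map from a graph $\widetilde{\Gamma}$ to a graph $\Gamma$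 is a surjective (on vertices) adjacency-preserving map $\rho:\widetilde{\Gamma}\to\Gamma$ such that, for each vertex $x$ of $\Gamma$ and each $\widetilde{x}\in\rho^{-1}(x)$, the induced map from the set of neighbours of $\widetilde{x}$ to the set of neighbours of $x$ is bijective. If such a map exists, $\Gamma$ is said to be covered by $\widetilde{\Gamma}$. *)

(* Defs.v *)
From mathcomp Require Import all_boot all_order all_algebra.

Set Implicit Arguments.
Unset Strict Implicit.
Unset Printing Implicit Defensive.

Import GRing.Theory.

Record sgraph := SGraph {
  vertex :> finType;
  adj : rel vertex;
  adj_sym : symmetric adj;
  adj_irr : irreflexive adj }.

Definition connected (G : sgraph) : Prop := forall x y : G, connect (@adj G) x y.

(* For vertices in different components the value is #|G|, which is never the
   length of a shortest path. *)
Definition dist (G : sgraph) (x y : G) : nat :=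
  find (fun k => [exists p : k.-tuple G, path (@adj G) x p && (last x p == y)])
       (iota 0 #|G|).

Definition diameter (G : sgraph) : nat := \max_(x : G) \max_(y : G) dist x y.

Definition sphere (G : sgraph) (i : nat) (x : G) : {set G} :=
  [set y | dist x y == i].

Definition c_num (G : sgraph) (i : nat) (x y : G) : nat :=
  #|sphere 1 y :&: sphere i.-1 x|.

Definition b_num (G : sgraph) (i : nat) (x y : G) : nat :=
  #|sphere 1 y :&: sphere i.+1 x|.

Definition c_well_defined (G : sgraph) (i k : nat) : Prop :=
  forall x y : G, dist x y = i -> c_num i x y = k.

Definition b_well_defined (G : sgraph) (i k : nat) : Prop :=
  forall x y : G, dist x y = i -> b_num i x y = k.

Definition graph_iso (G H : sgraph) : Prop :=
  exists2 f : G -> H, bijective f & forall x y, adj (f x) (f y) = adj x y.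

Section Induced.
Variables (G : sgraph) (A : {set G}).

Definition induced_adj (x y : {z : G | z \in A}) : bool := adj (val x) (val y).

Fact induced_sym : symmetric induced_adj.
Proof. by move=> x y; apply: adj_sym. Qed.

Fact induced_irr : irreflexive induced_adj.
Proof. by move=> x; apply: adj_irr. Qed.

Definition induced : sgraph := SGraph induced_sym induced_irr.
End Induced.

Definition local_graph (G : sgraph) (x : G) : sgraph := induced (sphere 1 x).

Section Complete.
Variable n : nat.

Definition complete_adj (i j : 'I_n) : bool := i != j.

Fact complete_sym : symmetric complete_adj.
Proof. by move=> i j; rewrite /complete_adj eq_sym. Qed.

Fact complete_irr : irreflexive complete_adj.
Proof. by move=> i; rewrite /complete_adj eqxx. Qed.

Definition complete : sgraph := SGraph complete_sym complete_irr.
End Complete.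

Section CartesianProduct.
Variables G H : sgraph.

Definition cart_adj (u v : G * H) : bool :=
  (u.1 == v.1) && adj u.2 v.2 || adj u.1 v.1 && (u.2 == v.2).

Fact cart_sym : symmetric cart_adj.
Proof.
by move=> u v; rewrite /cart_adj (eq_sym u.1) (eq_sym u.2) !(adj_sym u.1, adj_sym u.2).
Qed.

Fact cart_irr : irreflexive cart_adj.
Proof. by move=> u; rewrite /cart_adj !adj_irr andbF. Qed.

Definition cart_prod : sgraph := SGraph cart_sym cart_irr.
End CartesianProduct.

Definition grid (n m : nat) : sgraph := cart_prod (complete n) (complete m).

Section Bilinear.
Variables d e : nat.

Definition bil2_adj (A B : 'M['F_2]_(d, e)) : bool := \rank (A - B)%R == 1.

Fact bil2_sym : symmetric bil2_adj.
Proof. by move=> A B; rewrite /bil2_adj -opprB mxrank_opp. Qed.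

Fact bil2_irr : irreflexive bil2_adj.
Proof. by move=> A; rewrite /bil2_adj subrr mxrank0. Qed.

Definition Bil2 : sgraph := SGraph bil2_sym bil2_irr.
End Bilinear.

Definition neighbours (G : sgraph) (x : G) : {set G} := [set y | adj x y].

Lemma sphere1E (G : sgraph) (x : G) : sphere 1 x = neighbours x.
Proof.
apply/setP=> y; rewrite !inE /dist.
have : 0 < #|G| by apply/card_gt0P; exists x.
case E: #|G| => [//|N] _ /=.
have -> : [exists p : 0.-tuple G, path (@adj G) x p && (last x p == y)] = (x == y).
  apply/existsP/idP => [[p]|xy]; first by rewrite tuple0.
  by exists [tuple]; rewrite /= xy.
have [<-|xy] := eqVneq x y; first by rewrite adj_irr.
case: N E => [/eqP/fintype1P[z zP]|N _ /=]; first by rewrite (zP x) (zP y) eqxx in xy.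
have -> : [exists p : 1.-tuple G, path (@adj G) x p && (last x p == y)] = adj x y.
  apply/existsP/idP => [[p]|xy1].
    by case/tupleP: p => z p; rewrite tuple0 /= andbT => /andP[? /eqP<-].
  by exists [tuple y]; rewrite /= xy1 eqxx.
by case: (adj x y).
Qed.

Definition covering_map (G H : sgraph) (rho : G -> H) : Prop :=
  [/\ forall y : H, exists x : G, rho x = y,
      forall x y : G, adj x y -> adj (rho x) (rho y),
      forall x : G, {in neighbours x &, injective rho}
    & forall x : G, rho @: neighbours x = neighbours (rho x)].

Definition covered_by (H G : sgraph) : Prop :=
  exists rho : G -> H, covering_map rho.

(* Main.v *)
Require Import Defs.
From mathcomp Require Import all_boot all_order all_algebra.
From Stdlib Require Import Classical FunctionalExtensionality.

(* Each common neighbourhood of vertices at distance 2 is a hexagon, filling all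
   but a transversal of a 3 x 3 subgrid of the local grid at x.  Two rows and two
   columns lie in exactly one such subgrid, and comparing the subgrids seen from
   adjacent vertices, with b_2 providing common neighbours, shows that the third
   row depends on the two rows alone.  The resulting operation on the rows,
   completed by a zero, is an elementary abelian 2-group, so the rows are the
   nonzero vectors of F_2^d, the columns those of F_2^e, and the local grid is that
   of the matrices of rank 1.  Carrying such a coordinatization from x to its
   neighbour with coordinates (u, v) defines a map T u v on coordinatized vertices
   which is biadditive in (u, v).  Biadditivity forces these maps to commute, so the
   additive group of matrices acts, and following the base vertex along the orbit
   of one coordinatization is the covering map. *)

Set Implicit Arguments.
Unset Strict Implicit.
Unset Printing Implicit Defensive.

Import GRing.Theory.

(** * Hexagons in grids *)

Lemma neq_swap (T : eqType) (x y : T) : x != y -> (y == x) = false.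
Proof. by rewrite eq_sym => /negPf. Qed.

Ltac neq_simpl := repeat match goal with
  H : is_true (~~ (_ == _)) |- _ => rewrite ?(negPf H) ?(neq_swap H); clear H end.

Ltac eqcases := repeat (rewrite ?eqxx ?andbF ?andbT ?orbF ?orbT ?addbF ?addFb //=;
  match goal with
  | H : is_true (~~ (?x == ?x)) |- _ => by rewrite eqxx in H
  | H : is_true (~~ (?x == ?y)) |- context [?x == ?y] => rewrite (negPf H)
  | H : is_true (~~ (?x == ?y)) |- context [?y == ?x] => rewrite (neq_swap H)
  | |- context [?x == ?y] => case: (eqVneq x y) => [?|?]; subst
  end).

Definition hexagon (I J : eqType) (a p k : I) (b q l : J) (i : I) (j : J) :=
  [|| (i == a) && ((j == b) || (j == q)),
      (i == p) && ((j == b) || (j == l))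
    | (i == k) && ((j == q) || (j == l))].

Lemma hexagon_of_mates (I J : finType) (H : I -> J -> bool) (a p : I) (b q : J) :
    #|[set u : I * J | H u.1 u.2]| = 6 ->
    (forall i j, H i j -> exists2 i', i' != i &
       forall h, H h j = (h == i) || (h == i')) ->
    (forall i j, H i j -> exists2 j', j' != j &
       forall h, H i h = (h == j) || (h == j')) ->
    a != p -> b != q -> H a b -> H p b -> H a q ->
  exists k l, [/\ uniq [:: a; p; k], uniq [:: b; q; l]
                & forall i j, H i j = hexagon a p k b q l i j].
Proof.
move=> H6 col row ap bq Hab Hpb Haq.
have small (s : seq (I * J)) : uniq s -> all (fun u => H u.1 u.2) s -> size s <= 6.
  move=> us /allP Hs; rewrite -H6 cardE; apply: uniq_leq_size => // u /Hs.
  by rewrite mem_enum inE.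
have full (s : seq (I * J)) : uniq s -> all (fun u => H u.1 u.2) s -> size s = 6 ->
    forall i j, H i j = ((i, j) \in s).
  move=> us /allP Hs s6 i j.
  have sub : {subset s <= enum [set u : I * J | H u.1 u.2]}.
    by move=> u /Hs; rewrite mem_enum inE.
  have [] := uniq_min_size us sub; first by rewrite -cardE H6 s6.
  by move=> _ /(_ (i, j)) ->; rewrite mem_enum inE.
have rowa j : H a j = (j == b) || (j == q).
  have [j' j'b E] := row _ _ Hab; rewrite E; move: Haq; rewrite E eq_sym (negPf bq) /=.
  by move=> /eqP->.
have colb i : H i b = (i == a) || (i == p).
  have [i' i'a E] := col _ _ Hab; rewrite E; move: Hpb; rewrite E eq_sym (negPf ap) /=.
  by move=> /eqP->.
have [l lb rowp] := row _ _ Hpb.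
have [k ka colq] := col _ _ Haq.
have kp_lq : (k == p) = (l == q).
  have := rowp q; rewrite colq eq_sym (negPf ap) /= (eq_sym q) (negPf bq) /=.
  by rewrite (eq_sym k) (eq_sym l) => ->.
have lq : l != q.
  apply/negP => lq; have kp : k == p by rewrite kp_lq.
  move/eqP: lq => lq; move/eqP: kp => kp; subst l k.
  have /subsetPn[[i j]] : ~~ ([set u : I * J | H u.1 u.2]
      \subset [:: (a, b); (p, b); (a, q); (p, q)]).
    apply/negP => /subset_leq_card; rewrite H6.
    by move/leq_trans/(_ (card_size _)).
  rewrite !inE /= => Hij nin.
  have ia : i != a.
    by apply/negP => /eqP E; move: Hij nin; rewrite E rowa => /orP[]/eqP->; rewrite eqxx ?orbT.
  have ip : i != p.
    by apply/negP => /eqP E; move: Hij nin; rewrite E rowp => /orP[]/eqP->; rewrite eqxx ?orbT.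
  have jb : j != b.
    by apply/negP => /eqP E; move: Hij; rewrite E colb (negPf ia) (negPf ip).
  have jq : j != q.
    by apply/negP => /eqP E; move: Hij; rewrite E colq (negPf ia) (negPf ip).
  have [i' i'i coli] := col _ _ Hij; have [j' j'j rowj] := row _ _ Hij.
  have Hi'j : H i' j by rewrite coli eqxx orbT.
  have Hij' : H i j' by rewrite rowj eqxx orbT.
  have := small [:: (a,b); (p,b); (a,q); (p,q); (i, j); (i',j); (i,j')].
  rewrite [all _ _]/= Hab Hpb Haq Hij Hi'j Hij' rowp eqxx orbT.
  rewrite /= !inE !xpair_eqE !eqxx; neq_simpl.
  by rewrite /= ?andbF /= => /(_ isT isT).
have kp : k != p by rewrite kp_lq.
have Hpl : H p l by rewrite rowp eqxx orbT.
have Hkq : H k q by rewrite colq eqxx orbT.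
have [k' k'p coll] := col _ _ Hpl.
have Hk'l : H k' l by rewrite coll eqxx orbT.
have k'a : k' != a.
  by apply/negP => /eqP E; move: Hk'l; rewrite E rowa (negPf lb) (negPf lq).
have [l' l'q rowk] := row _ _ Hkq.
have Hkl' : H k l' by rewrite rowk eqxx orbT.
have [Ek|kk'] := eqVneq k' k; last first.
  have := small [:: (a,b); (p,b); (a,q); (p,l); (k,q); (k',l); (k,l')].
  rewrite [all _ _]/= Hab Hpb Haq Hpl Hkq Hk'l Hkl'.
  rewrite /= !inE !xpair_eqE !eqxx; neq_simpl.
  by rewrite /= ?andbF /= => /(_ isT isT).
exists k, l; split.
- by rewrite /= !inE; neq_simpl.
- by rewrite /= !inE; neq_simpl.
subst k'; move=> i j; rewrite (full [:: (a,b); (p,b); (a,q); (p,l); (k,q); (k,l)]) //.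
- rewrite !inE !xpair_eqE /hexagon.
  by do !case: (_ == _).
- by rewrite /= !inE !xpair_eqE !eqxx; neq_simpl; rewrite /= ?andbF.
- by rewrite /= Hab Hpb Haq Hpl Hkq Hk'l.
Qed.

(** * Coordinates on local graphs *)

Section Frames.
Variable G : sgraph.

Definition at2 (x y : G) :=
  [&& x != y, ~~ adj x y & [exists v, adj x v && adj y v]].

Definition beyond2 (x y : G) :=
  [&& x != y, ~~ adj x y & ~~ [exists v, adj x v && adj y v]].

Definition frame (I J : finType) (x : G) (f : I -> J -> G) :=
  [/\ forall i j, adj x (f i j),
      forall v, adj x v -> exists i j, v = f i j,
      forall i j i' j', (f i j == f i' j') = (i == i') && (j == j')
    & forall i j i' j', adj (f i j) (f i' j') = (i == i') (+) (j == j')].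

(* [g] coordinatizes the neighbour [f a b] of [x], with all common neighbours of the
   two keeping their coordinates and [x] receiving those of [f a b]. *)
Definition moved (I J : finType) (a : I) (b : J) (x : G) (f g : I -> J -> G) :=
  [/\ frame (f a b) g,
      g a b = x,
      forall p, p != a -> g p b = f p b
    & forall q, q != b -> g a q = f a q].

Definition flip (I J : finType) (f : I -> J -> G) j i := f i j.

Record locally_grid (I J : finType) : Prop := LocallyGrid {
  lg_rows : 2 < #|I|;
  lg_cols : 2 < #|J|;
  lg_frame : forall x, exists f : I -> J -> G, frame x f;
  lg_mu : forall x y, at2 x y -> #|[set v | adj x v && adj y v]| = 6;
  lg_b2 : forall x y, at2 x y ->
    (#|I| - 3) * (#|J| - 3) <= #|[set w | adj y w && beyond2 x w]| }.

Lemma at2_sym x y : at2 x y = at2 y x.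
Proof.
rewrite /at2 eq_sym adj_sym; congr [&& _, _ & _].
by apply: eq_existsb => v; rewrite andbC.
Qed.

Lemma at2I x y v : x != y -> ~~ adj x y -> adj x v -> adj y v -> at2 x y.
Proof. by move=> xy axy xv yv; rewrite /at2 xy axy; apply/existsP; exists v; rewrite xv. Qed.

Lemma at2P x y : at2 x y -> [/\ x != y, ~~ adj x y & exists2 v, adj x v & adj y v].
Proof. by case/and3P=> ? ? /existsP[v /andP[? ?]]; split=> //; exists v. Qed.

Lemma frame_adj (I J : finType) x (f : I -> J -> G) i j : frame x f -> adj x (f i j).
Proof. by case. Qed.

Lemma frame_ex (I J : finType) x (f : I -> J -> G) v :
  frame x f -> adj x v -> exists i j, v = f i j.
Proof. by case=> _ + _ _; apply. Qed.

Lemma frame_eq (I J : finType) x (f : I -> J -> G) i j i' j' : frame x f ->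
  (f i j == f i' j') = (i == i') && (j == j').
Proof. by case. Qed.

Lemma frame_adj2 (I J : finType) x (f : I -> J -> G) i j i' j' : frame x f ->
  adj (f i j) (f i' j') = (i == i') (+) (j == j').
Proof. by case. Qed.

Lemma frame_flip (I J : finType) x (f : I -> J -> G) : frame x f -> frame x (flip f).
Proof.
case=> fx fs fi fa; split=> [j i|v /fs[i [j ->]]|j i j' i'|j i j' i'].
- exact: fx.
- by exists j, i.
- by rewrite fi andbC.
- by rewrite fa addbC.
Qed.

Lemma moved_flip (I J : finType) a b x (f g : I -> J -> G) :
  moved a b x f g -> moved b a x (flip f) (flip g).
Proof. by case=> [/frame_flip gf gx gb ga]; split. Qed.

Lemma locally_grid_flip (I J : finType) : locally_grid I J -> locally_grid J I.
Proof.
case=> h1 h2 h3 h4 h5; split=> // [x|x y /h5]; last by rewrite mulnC.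
by have [f /frame_flip] := h3 x; exists (flip f).
Qed.

Section Coordinates.
Variables I J : finType.
Implicit Types (a p k i : I) (b q l j : J) (x y z w v : G) (f g : I -> J -> G).

Lemma frame_eq_base (K L : finType) (z x : G) (g : K -> L -> G) (i0 i : K) (j0 j : L) :
    frame z g -> x = g i0 j0 -> adj x (g i j) -> (i0 == i) (+) (j0 == j).
Proof. by move=> zg ->; rewrite (frame_adj2 _ _ _ _ zg). Qed.

(* In the grid [g] around [f a b] the lines [f _ b] and [f a _] meet in [x]; they are
   of different types because their other vertices are not adjacent. *)
Lemma frame_cross (K L : finType) x f (g : K -> L -> G) a b p0 q0 (i0 i1 : K) (j0 : L) :
    frame x f -> frame (f a b) g -> x = g i0 j0 ->
    p0 != a -> q0 != b -> f p0 b = g i1 j0 ->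
  exists (s : I -> K) (t : J -> L), [/\ injective s /\ injective t, s a = i0, t b = j0,
     forall p, p != a -> f p b = g (s p) j0 & forall q, q != b -> f a q = g i0 (t q)].
Proof.
move=> xf zg ex p0a q0b e1.
have cross p q (i i' : K) (j j' : L) : p != a -> q != b -> f p b = g i j -> f a q = g i' j' ->
    (i == i') (+) (j == j') = false /\ (i == i') && (j == j') = false.
  move=> pa qb e e'; rewrite -(frame_adj2 _ _ _ _ zg) -(frame_eq _ _ _ _ zg) -e -e'.
  by rewrite (frame_adj2 _ _ _ _ xf) (frame_eq _ _ _ _ xf); neq_simpl.
have Q q : exists j : L, q = b /\ j = j0 \/ q != b /\ f a q = g i0 j /\ j != j0.
  have [->|qb] := eqVneq q b; first by exists j0; left.
  have [|i [j e]] := frame_ex zg (v := f a q).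
    by rewrite (frame_adj2 _ _ _ _ xf) eqxx; neq_simpl.
  have D := frame_adj a q xf; rewrite e in D; have {D} H := frame_eq_base zg ex D.
  have [D1 D2] := cross _ _ _ _ _ _ p0a qb e1 e; exists j; right; rewrite e.
  have nj : (j0 == j) = false by apply/negP => jj; move: D1 D2; rewrite jj andbT addbT => /negbFE->.
  by rewrite (eq_sym j) nj; move: H; rewrite nj addbF => /eqP<-.
have [t tP] := fin_all_exists Q.
have e2 : f a q0 = g i0 (t q0) /\ t q0 != j0.
  by case: (tP q0) => [[E _]|[_]//]; rewrite E eqxx in q0b.
have P p : exists i : K, p = a /\ i = i0 \/ p != a /\ f p b = g i j0 /\ i != i0.
  have [->|pa] := eqVneq p a; first by exists i0; left.
  have [|i [j e]] := frame_ex zg (v := f p b).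
    by rewrite (frame_adj2 _ _ _ _ xf) eqxx; neq_simpl.
  have D := frame_adj p b xf; rewrite e in D; have {D} H := frame_eq_base zg ex D.
  have [D1 D2] := cross _ _ _ _ _ _ pa q0b e e2.1; exists i; right; rewrite e.
  have ni : (i == i0) = false by apply/negP => ii; move: D1 D2; rewrite ii addTb => /negbFE->.
  by rewrite ni; move: H; rewrite eq_sym ni => /eqP<-.
have [s sP] := fin_all_exists P.
exists s, t; split.
- split=> p p'.
    case: (sP p) (sP p') => [[-> ->]|[_ [e n]]] [[-> ->]|[_ [e' n']]] E //.
    - by rewrite E eqxx in n'.
    - by rewrite E eqxx in n.
    - by apply/eqP; have := frame_eq p b p' b xf; rewrite e e' E !eqxx andbT.
  case: (tP p) (tP p') => [[-> ->]|[_ [e n]]] [[-> ->]|[_ [e' n']]] E //.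
  - by rewrite E eqxx in n'.
  - by rewrite E eqxx in n.
  - by apply/eqP; have := frame_eq a p a p' xf; rewrite e e' E !eqxx.
- by case: (sP a) => [[]|[]] //; rewrite eqxx.
- by case: (tP b) => [[]|[]] //; rewrite eqxx.
- by move=> p pa; case: (sP p) => [[E]|[_ []]] //; rewrite E eqxx in pa.
- by move=> q qb; case: (tP q) => [[E]|[_ []]] //; rewrite E eqxx in qb.
Qed.

Lemma frame_reindex x f (s : I -> I) (t : J -> J) :
  injective s -> injective t -> frame x f -> frame x (fun i j => f (s i) (t j)).
Proof.
move=> si ti [fx fs fi fa]; split=> [//|v /fs[i [j ->]]|i j i' j'|i j i' j'].
- have [s' _ sK] := injF_bij si; have [t' _ tK] := injF_bij ti.
  by exists (s' i), (t' j); rewrite sK tK.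
- by rewrite fi !(inj_eq si) !(inj_eq ti).
- by rewrite fa !(inj_eq si) !(inj_eq ti).
Qed.

Lemma frame_reindex_swap x f (s : I -> J) (t : J -> I) :
  injective s -> injective t -> frame x f -> frame x (fun i j => f (t j) (s i)).
Proof.
move=> si ti.
have IJ : #|I| = #|J| by apply/eqP; rewrite eqn_leq (leq_card _ si) (leq_card _ ti).
case=> [fx fs fi fa]; split=> [//|v /fs[i [j ->]]|i j i' j'|i j i' j'].
- have [s' _ sK] := inj_card_bij si (eq_leq (esym IJ)).
  have [t' _ tK] := inj_card_bij ti (eq_leq IJ).
  by exists (s' j), (t' i); rewrite sK tK.
- by rewrite fi !(inj_eq si) !(inj_eq ti) andbC.
- by rewrite fa !(inj_eq si) !(inj_eq ti) addbC.
Qed.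

Hypothesis lg : locally_grid I J.

Lemma other_row a : exists p, p != a.
Proof.
have /ltnW/card_gt1P[p [p' [_ _]]] := lg_rows lg.
by case: (eqVneq p a) => [->|]; [exists p'; rewrite eq_sym|exists p].
Qed.

Lemma other_col b : exists q, q != b.
Proof.
have /ltnW/card_gt1P[p [p' [_ _]]] := lg_cols lg.
by case: (eqVneq p b) => [->|]; [exists p'; rewrite eq_sym|exists p].
Qed.

Lemma moved_exists x f a b : frame x f -> exists g, moved a b x f g.
Proof.
move=> xf; have [g zg] := lg_frame lg (f a b).
have [p0 p0a] := other_row a; have [q0 q0b] := other_col b.
have [|i0 [j0 ex]] := frame_ex zg (v := x); first by rewrite adj_sym (frame_adj _ _ xf).
have [|i1 [j1 e1]] := frame_ex zg (v := f p0 b).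
  by rewrite (frame_adj2 _ _ _ _ xf) eqxx; neq_simpl.
have := frame_adj p0 b xf; rewrite e1 => /(frame_eq_base zg ex).
have [Ej _|_] := eqVneq j0 j1.
  subst j1.
  have [s [t [[si ti] sa tb hs ht]]] := frame_cross xf zg ex p0a q0b e1.
  exists (fun i j => g (s i) (t j)); split; first exact: frame_reindex.
  - by rewrite sa tb.
  - by move=> p pa; rewrite tb hs.
  - by move=> q qb; rewrite sa ht.
rewrite addbF => /eqP Ei; subst i1.
have [s [t [[si ti] sa tb hs ht]]] := frame_cross xf (frame_flip zg) ex p0a q0b e1.
exists (fun i j => g (t j) (s i)); split; first exact: frame_reindex_swap.
- by rewrite sa tb.
- by move=> p pa; rewrite tb hs.
- by move=> q qb; rewrite sa ht.
Qed.

Lemma moved_frame x f g a b : moved a b x f g -> frame (f a b) g. Proof. by case. Qed.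
Lemma moved_base x f g a b : moved a b x f g -> g a b = x. Proof. by case. Qed.
Lemma moved_row x f g a b p : moved a b x f g -> p != a -> g p b = f p b.
Proof. by case=> _ _ + _; apply. Qed.
Lemma moved_col x f g a b q : moved a b x f g -> q != b -> g a q = f a q.
Proof. by case=> _ _ _; apply. Qed.

Lemma moved_at2 x f g a b p q : frame x f -> moved a b x f g -> p != a -> q != b ->
  at2 x (g p q).
Proof.
move=> xf m pa qb; have zg := moved_frame m.
apply: (@at2I _ _ (f a b)).
- by rewrite -(moved_base m) (frame_eq _ _ _ _ zg); neq_simpl.
- by rewrite -(moved_base m) (frame_adj2 _ _ _ _ zg); neq_simpl.
- exact: frame_adj xf.
- by rewrite adj_sym; exact: frame_adj zg.
Qed.

(* The fourth corner: the 2-path [f p b], [f a b], [f a q] of the local grid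
   determines the vertex outside it. *)
Lemma moved_corner x f g a b p q y : frame x f -> moved a b x f g ->
    p != a -> q != b -> x != y -> ~~ adj x y ->
    adj y (f a b) -> adj y (f p b) -> adj y (f a q) -> y = g p q.
Proof.
move=> xf m pa qb xy axy yab ypb yaq; have zg := moved_frame m.
have [|i [j ey]] := frame_ex zg (v := y); first by rewrite adj_sym.
move: ypb yaq axy xy.
rewrite -(moved_row m) // -(moved_col m) // -(moved_base m) ey.
rewrite !(frame_adj2 _ _ _ _ zg) (frame_eq _ _ _ _ zg) (eq_sym a) (eq_sym b).
have [->|ia] := eqVneq i a; have [->|jb] := eqVneq j b => //=.
by rewrite addbF => /eqP -> /eqP ->.
Qed.

Lemma corner_unique x f a b p q y y' : frame x f -> p != a -> q != b ->
    x != y -> ~~ adj x y -> adj y (f a b) -> adj y (f p b) -> adj y (f a q) ->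
    x != y' -> ~~ adj x y' -> adj y' (f a b) -> adj y' (f p b) -> adj y' (f a q) ->
  y = y'.
Proof.
move=> xf pa qb; have [g m] := moved_exists a b xf; intros.
by rewrite (moved_corner (y := y) xf m pa qb) // -(moved_corner (y := y') xf m pa qb).
Qed.

Lemma moved_corner_adj x f g a b p q : frame x f -> moved a b x f g -> p != a -> q != b ->
  [/\ adj (g p q) (f a b), adj (g p q) (f p b) & adj (g p q) (f a q)].
Proof.
move=> xf m pa qb; have zg := moved_frame m; split.
- by rewrite adj_sym; exact: frame_adj zg.
- by rewrite -(moved_row m pa) (frame_adj2 _ _ _ _ zg) eqxx; neq_simpl.
- by rewrite -(moved_col m qb) (frame_adj2 _ _ _ _ zg) eqxx; neq_simpl.
Qed.

Lemma mates x f y i j : frame x f -> x != y -> ~~ adj x y -> adj y (f i j) ->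
  exists p q, [/\ p != i, q != j,
     forall h, adj y (f h j) = (h == i) || (h == p)
   & forall h, adj y (f i h) = (h == j) || (h == q)].
Proof.
move=> xf xy axy yij; have [g m] := moved_exists i j xf; have zg := moved_frame m.
have [|p [q ey]] := frame_ex zg (v := y); first by rewrite adj_sym.
move: xy axy; rewrite -(moved_base m) ey (frame_eq _ _ _ _ zg) (frame_adj2 _ _ _ _ zg).
have [->|ip] := eqVneq i p; have [->|jq] := eqVneq j q => //= _ _.
exists p, q; split; rewrite 1?eq_sym // => h.
- have [->|hi] := eqVneq h i; first by rewrite -ey yij.
  rewrite -(moved_row m hi) (frame_adj2 _ _ _ _ zg) (eq_sym q) (negPf jq) addbF.
  by rewrite eq_sym.
- have [->|hj] := eqVneq h j; first by rewrite -ey yij.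
  rewrite -(moved_col m hj) (frame_adj2 _ _ _ _ zg) (eq_sym p) (negPf ip) addFb.
  by rewrite eq_sym.
Qed.

Lemma at2_hexagon x f y a b p q : frame x f -> at2 x y -> p != a -> q != b ->
    adj y (f a b) -> adj y (f p b) -> adj y (f a q) ->
  exists k l, [/\ uniq [:: a; p; k], uniq [:: b; q; l]
    & forall i j, adj y (f i j) = hexagon a p k b q l i j].
Proof.
move=> xf xy pa qb yab ypb yaq; have [nxy axy _] := at2P xy.
apply: (hexagon_of_mates (H := fun i j => adj y (f i j))) => //.
- have -> : 6 = #|[set v | adj x v && adj y v]| by rewrite (lg_mu lg).
  have fi : injective (fun u : I * J => f u.1 u.2).
    move=> [i j] [i' j'] /= /eqP; rewrite (frame_eq _ _ _ _ xf) => /andP[/eqP-> /eqP->] //.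
  rewrite -(card_imset _ fi); congr #|pred_of_set _|; apply/setP => v.
  rewrite !inE; apply/imsetP/andP => [[u]|[xv]].
    by rewrite inE => yu ->; rewrite yu (frame_adj _ _ xf).
  by have [i [j ->]] := frame_ex xf xv => yv; exists (i, j); rewrite ?inE.
- by move=> i j /(mates xf nxy axy)[h [_ [? _ ? _]]]; exists h.
- by move=> i j /(mates xf nxy axy)[_ [h [_ ? _ ?]]]; exists h.
- by rewrite eq_sym.
- by rewrite eq_sym.
Qed.

Lemma at2_hexagon_at x f y a b : frame x f -> at2 x y -> adj y (f a b) ->
  exists p k q l, [/\ uniq [:: a; p; k], uniq [:: b; q; l]
    & forall i j, adj y (f i j) = hexagon a p k b q l i j].
Proof.
move=> xf xy yab; have [nxy axy _] := at2P xy.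
have [p [q [pa qb hp hq]]] := mates xf nxy axy yab.
have [||k [l E]] := at2_hexagon xf xy pa qb yab; rewrite ?hp ?hq ?eqxx ?orbT //.
by exists p, k, q, l.
Qed.

End Coordinates.
End Frames.

(** * The 3 x 3 subgrids *)

Section Special.
Variables (G : sgraph) (I J : finType).
Hypothesis lg : locally_grid G I J.
Implicit Types (a p k i : I) (b q l j : J) (x y z w v : G) (f g : I -> J -> G).

(* Up to the choice of the transversal, that is, of the order of the labels, this
   depends only on the 3 x 3 subgrid [{a, p, k} x {b, q, l}]. *)
Definition special x f a p k b q l :=
  [/\ uniq [:: a; p; k], uniq [:: b; q; l]
    & exists2 y, at2 x y & forall i j, adj y (f i j) = hexagon a p k b q l i j].

Lemma uniq3P (T : eqType) (u v w : T) :
  uniq [:: u; v; w] = [&& u != v, u != w & v != w].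
Proof. by rewrite /= !inE negb_or andbT andbA. Qed.

Lemma special_neq x f a p k b q l : special x f a p k b q l ->
  [/\ a != p, a != k & p != k] /\ [/\ b != q, b != l & q != l].
Proof. by case; rewrite !uniq3P => /and3P[-> -> ->] /and3P[-> -> ->]. Qed.

Lemma special_exists x f a p b q : frame x f -> a != p -> b != q ->
  exists k l, special x f a p k b q l.
Proof.
rewrite eq_sym (eq_sym b) => xf pa qb; have [g m] := moved_exists lg a b xf.
have [h1 h2 h3] := moved_corner_adj xf m pa qb; have h0 := moved_at2 xf m pa qb.
have [k [l [u1 u2 h]]] := at2_hexagon lg xf h0 pa qb h1 h2 h3.
by exists k, l; split=> //; exists (g p q).
Qed.

Lemma hexagonE (a p k : I) (b q l : J) :
  [/\ hexagon a p k b q l a b, hexagon a p k b q l a q, hexagon a p k b q l p b,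
      hexagon a p k b q l p l & hexagon a p k b q l k q /\ hexagon a p k b q l k l].
Proof. by rewrite /hexagon !eqxx !orbT. Qed.

Lemma special_unique x f a p k b q l k' l' : frame x f ->
  special x f a p k b q l -> special x f a p k' b q l' -> k = k' /\ l = l'.
Proof.
move=> xf s s'.
have [[ap ak pk] [bq bl ql]] := special_neq s.
have [[_ ak' pk'] [_ bl' ql']] := special_neq s'.
case: s => _ _ [y /at2P[y1 y2 _] hy]; case: s' => _ _ [y' /at2P[y1' y2' _] hy'].
have E : y = y'.
  by apply: (@corner_unique _ _ _ lg x f a b p q) => //;
    rewrite ?(eq_sym p) ?(eq_sym q) // ?hy ?hy' /hexagon ?eqxx ?orbT.
subst y'; split.
- have := hy k q; rewrite hy' /hexagon !eqxx (eq_sym q b); neq_simpl.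
  rewrite /= ?orbT ?andbF ?andbT ?orbF.
  by move/eqP.
- have := hy p l; rewrite hy' /hexagon !eqxx (eq_sym l b); neq_simpl.
  rewrite /= ?orbT ?andbF ?andbT ?orbF.
  by move/eqP.
Qed.

Lemma special_swap12 x f a p k b q l :
  special x f a p k b q l -> special x f p a k b l q.
Proof.
case=> u1 u2 [y xy h]; move: u1 u2; rewrite !uniq3P => /and3P[u1 u2 u3] /and3P[v1 v2 v3].
split; first by rewrite uniq3P; neq_simpl.
  by rewrite uniq3P; neq_simpl.
exists y => // i j; rewrite h /hexagon; do !case: (_ == _) => //.
Qed.

Lemma special_swap23 x f a p k b q l :
  special x f a p k b q l -> special x f a k p q b l.
Proof.
case=> u1 u2 [y xy h]; move: u1 u2; rewrite !uniq3P => /and3P[u1 u2 u3] /and3P[v1 v2 v3].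
split; first by rewrite uniq3P; neq_simpl.
  by rewrite uniq3P; neq_simpl.
exists y => // i j; rewrite h /hexagon; do !case: (_ == _) => //.
Qed.

(* [y] sees [x] in a hexagon [p, a, k'] x [q, b, l'] as well; the vertex of the
   local grid of [y] in position [(p, l')], missing from that hexagon, has the
   swapped hexagon at [x]. *)
Lemma special_swap_cols x f a p k b q l : frame x f ->
  special x f a p k b q l -> special x f a p k b l q.
Proof.
move=> xf s; have [[ap ak pk] [bq bl ql]] := special_neq s.
case: s => u1 u2 [y xy hy].
have [nxy axy _] := at2P xy.
have pa : p != a by rewrite eq_sym.
have qb : q != b by rewrite eq_sym.
have [hab haq hpb hpl [hkq hkl]] := hexagonE a p k b q l.
have [g m] := moved_exists lg a b xf; have zg := moved_frame m.
have ey : y = g p q by apply: (moved_corner xf m) => //; rewrite ?hy.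
have [h m'] := moved_exists lg p q zg; rewrite -?ey in m'; have yh := moved_frame m'.
rewrite -ey in yh.
have hz : h p q = f a b by rewrite (moved_base m').
have hpb' : h p b = f p b by rewrite (moved_col m') 1?eq_sym // (moved_row m).
have haq' : h a q = f a q by rewrite (moved_row m') 1?eq_sym // (moved_col m).
have yx : at2 y x by rewrite at2_sym.
have [|||||k' [l' [v1 v2 hx]]] := at2_hexagon lg yh yx (a := p) (b := q) (p := a) (q := b) => //.
- by rewrite hz; exact: frame_adj xf.
- by rewrite haq'; exact: frame_adj xf.
- by rewrite hpb'; exact: frame_adj xf.
move: v1 v2; rewrite !uniq3P => /and3P[v1 v2 v3] /and3P[w1 w2 w3].
have [_ _ _ xal [xkb xkl]] := hexagonE p a k' q b l'.
have identify i j : hexagon p a k' q b l' i j ->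
    exists i' j', h i j = f i' j' /\ hexagon a p k b q l i' j'.
  move=> H; have [|i' [j' e]] := frame_ex xf (v := h i j); first by rewrite hx.
  by exists i', j'; split=> //; rewrite -hy -e (frame_adj _ _ yh).
have e1 : h a l' = f k q.
  have [i [j [e H]]] := identify _ _ xal; rewrite e.
  have E1 : (i == a) (+) (j == q).
    by rewrite -(frame_adj2 _ _ _ _ xf) -e -haq' (frame_adj2 _ _ _ _ yh) eqxx; neq_simpl.
  have E2 : (i == a) (+) (j == b) = false.
    by rewrite -(frame_adj2 _ _ _ _ xf) -e -hz (frame_adj2 _ _ _ _ yh); neq_simpl.
  have E3 : (i == a) && (j == b) = false.
    by rewrite -(frame_eq _ _ _ _ xf) -e -hz (frame_eq _ _ _ _ yh); neq_simpl.
  move: H E1 E2 E3; rewrite /hexagon; clear -ap ak pk bq bl ql.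
  by eqcases.
have e2 : adj (h p l') (f k l).
  have [i [j [e H]]] := identify _ _ xkl.
  suff <- : h k' l' = f k l by rewrite (frame_adj2 _ _ _ _ yh) eqxx; neq_simpl.
  rewrite e.
  have E1 : (i == k) (+) (j == q).
    by rewrite -(frame_adj2 _ _ _ _ xf) -e -e1 (frame_adj2 _ _ _ _ yh) eqxx; neq_simpl.
  have E2 : (i == a) (+) (j == q) = false.
    by rewrite -(frame_adj2 _ _ _ _ xf) -e -haq' (frame_adj2 _ _ _ _ yh); neq_simpl.
  have E3 : (i == a) && (j == q) = false.
    by rewrite -(frame_eq _ _ _ _ xf) -e -haq' (frame_eq _ _ _ _ yh); neq_simpl.
  move: H E1 E2 E3; rewrite /hexagon; clear -ap ak pk bq bl ql.
  by eqcases.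
pose y' := h p l'.
have y'x : ~~ adj x y' by rewrite hx /hexagon eqxx; neq_simpl; rewrite ?andbF.
have nxy' : x != y'.
  by apply: contraNneq axy => ->; rewrite adj_sym (frame_adj _ _ yh).
have y'ab : adj y' (f a b) by rewrite -hz (frame_adj2 _ _ _ _ yh) eqxx; neq_simpl.
have y'pb : adj y' (f p b) by rewrite -hpb' (frame_adj2 _ _ _ _ yh) eqxx; neq_simpl.
have y'kq : adj y' (f k q) by rewrite -e1 (frame_adj2 _ _ _ _ yh) eqxx; neq_simpl.
have y'y : y' <> y by move=> E; have := frame_adj p l' yh; rewrite -/y' E adj_irr.
have xy' : at2 x y' by apply: (at2I nxy' y'x) y'ab; exact: frame_adj xf.
have [_ [q' [_ q'b _ rowa]]] := mates lg xf nxy' y'x y'ab.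
have [|k'' [l'' [s1 s2 H]]] := at2_hexagon lg xf xy' pa q'b y'ab y'pb.
  by rewrite rowa eqxx orbT.
rewrite !uniq3P in s1 s2; case/and3P: s1 => s1 s2' s3; case/and3P: s2 => t1 t2 t3.
move: (y'kq); rewrite H /hexagon; move: (e2); rewrite -/y' H /hexagon => D1 D2.
have ek : k'' = k.
  by move: D1; rewrite (eq_sym k a) (eq_sym k p) (negPf ak) (negPf pk) /= => /andP[/eqP].
subst k''.
have el : q' = l /\ l'' = q.
  move: D1 D2; clear -ak pk ql y'y nxy' y'x H xf pa qb hy lg xy y'ab y'pb.
  rewrite (eq_sym k a) (eq_sym k p) (negPf ak) (negPf pk) eqxx /=.
  have [nxy axy _] := at2P xy.
  case/orP=> /eqP El /orP[]/eqP Eq.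
  - by rewrite Eq El eqxx in ql.
  - by rewrite El Eq.
  - subst; case: y'y; apply: (@corner_unique _ _ _ lg x f a b p q') => //;
    by rewrite ?hy ?H /hexagon !eqxx ?orbT.
  - by rewrite Eq El eqxx in ql.
case: el => e3 e4; subst q' l''; split=> //; last by exists y'.
by rewrite uniq3P; neq_simpl.
Qed.

Lemma special_cols12 x f a p k b q l : frame x f ->
  special x f a p k b q l -> special x f a p k q b l.
Proof.
move=> xf.
have cols13 q' b' l' : special x f a p k b' q' l' -> special x f a p k l' q' b'.
  by move/special_swap23/(special_swap_cols xf)/special_swap23.
by move/cols13/(special_swap_cols xf)/cols13.
Qed.

Lemma special_rows12 x f a p k b q l : frame x f ->
  special x f a p k b q l -> special x f p a k b q l.
Proof. by move=> xf /special_swap12/(special_swap_cols xf). Qed.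

Lemma special_rows23 x f a p k b q l : frame x f ->
  special x f a p k b q l -> special x f a k p b q l.
Proof. by move=> xf /special_swap23/(special_cols12 xf). Qed.

Lemma at2_pair x y w : at2 x y -> at2 x w -> adj y w ->
  exists v1 v2, [/\ adj x v1 && adj x v2, adj y v1 && adj y v2,
    adj w v1 && adj w v2 & adj v1 v2].
Proof.
move=> xy xw yw; have [nxy _ [v xv yv]] := at2P xy.
have [nxw axw [v' xv' wv']] := at2P xw.
have [h yh] := lg_frame lg y; have [a [b ev]] := frame_ex yh yv.
have yx : at2 y x by rewrite at2_sym.
have xab : adj x (h a b) by rewrite -ev.
have [p [k [q [l [u1 u2 H]]]]] := at2_hexagon_at lg yh yx xab.
have pair i j i1 j1 i2 j2 : w = h i j -> hexagon a p k b q l i1 j1 ->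
    hexagon a p k b q l i2 j2 -> (i == i1) (+) (j == j1) -> (i == i2) (+) (j == j2) ->
    (i1 == i2) (+) (j1 == j2) -> exists v1 v2, [/\ adj x v1 && adj x v2,
    adj y v1 && adj y v2, adj w v1 && adj w v2 & adj v1 v2].
  move=> -> h1 h2 d1 d2 d12; exists (h i1 j1), (h i2 j2).
  by rewrite !(frame_adj2 _ _ _ _ yh) !H h1 h2 d1 d2 !(frame_adj _ _ yh).
pose S := setX (~: [set:: [:: a; p; k]]) (~: [set:: [:: b; q; l]]).
have hi : injective (fun u : I * J => h u.1 u.2).
  by move=> [i j] [i' j'] /= /eqP; rewrite (frame_eq _ _ _ _ yh) => /andP[/eqP-> /eqP->].
have wE : w \notin [set w | adj y w && beyond2 x w].
  by rewrite inE; apply/negP => /andP[_ /and3P[_ _ /existsPn/(_ v')]]; rewrite xv' wv'.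
have sub : [set w | adj y w && beyond2 x w] \subset (fun u : I * J => h u.1 u.2) @: S.
  apply/subsetP => c; rewrite inE => /andP[yc /and3P[nxc axc /existsPn far]].
  have [i [j ec]] := frame_ex yh yc; apply/imsetP; exists (i, j) => //.
  have no i1 j1 : hexagon a p k b q l i1 j1 -> (i == i1) (+) (j == j1) = false.
    move=> h1; apply: contraNF (far (h i1 j1)).
    by rewrite H h1 ec (frame_adj2 _ _ _ _ yh).
  have noh : hexagon a p k b q l i j = false by rewrite -H -ec (negPf axc).
  have [hab haq hpb hpl [hkq hkl]] := hexagonE a p k b q l.
  move: (no _ _ hab) (no _ _ haq) (no _ _ hpb) (no _ _ hpl) (no _ _ hkq) (no _ _ hkl) noh.
  rewrite !inE /hexagon; move: u1 u2; rewrite !uniq3P => /and3P[u1 u2 u3] /and3P[v1 v2 v3].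
  clear -u1 u2 u3 v1 v2 v3.
  by eqcases.
have cS : #|(fun u : I * J => h u.1 u.2) @: S| <= #|[set w | adj y w && beyond2 x w]|.
  rewrite (card_imset _ hi) cardsX; apply: leq_trans (lg_b2 lg xy).
  have c3 (T : finType) (s : seq T) : uniq s -> #|~: [set:: s]| = #|T| - size s.
    by move=> us; rewrite [LHS]cardsCs setCK cardsE (card_uniqP us).
  by rewrite !c3.
have [i [j ew]] := frame_ex yh yw.
have : w \notin (fun u : I * J => h u.1 u.2) @: S.
  by move: sub; rewrite subEproper properEcard ltnNge cS andbF orbF => /eqP <-.
rewrite ew -[h i j]/((fun u : I * J => h u.1 u.2) (i, j)) (mem_imset _ _ hi) !inE.
have noh : hexagon a p k b q l i j = false by rewrite -H -ew (negPf axw).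
have [hab haq hpb hpl [hkq hkl]] := hexagonE a p k b q l.
move: (pair i j _ _ _ _ ew hab haq) (pair i j _ _ _ _ ew hpb hpl) (pair i j _ _ _ _ ew hkq hkl).
move: (pair i j _ _ _ _ ew hab hpb) (pair i j _ _ _ _ ew haq hkq) (pair i j _ _ _ _ ew hpl hkl).
move: noh.
rewrite -ew /hexagon; move: u1 u2; rewrite !uniq3P => /and3P[u1 u2 u3] /and3P[v1 v2 v3].
set X := exists v1, _.
clear -u1 u2 u3 v1 v2 v3.
by eqcases; auto.
Qed.

Lemma special_moved x f g a p k b q l : frame x f -> moved a b x f g ->
  special x f a p k b q l ->
  at2 (f a b) (f p q) /\ forall i j, adj (f p q) (g i j) = hexagon a p k b q l i j.
Proof.
move=> xf m s; have [[ap ak pk] [bq bl ql]] := special_neq s; have zg := moved_frame m.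
have [pa ka lb qb] : [/\ p != a, k != a, l != b & q != b] by rewrite !(eq_sym _ a) !(eq_sym _ b).
have far : at2 (f a b) (f p q).
  apply: (@at2I _ _ _ x).
  - by rewrite (frame_eq _ _ _ _ xf); neq_simpl.
  - by rewrite (frame_adj2 _ _ _ _ xf); neq_simpl.
  - by rewrite adj_sym (frame_adj _ _ xf).
  - by rewrite adj_sym (frame_adj _ _ xf).
split=> //.
have [||| k' [l' [u1 u2 H]]] := at2_hexagon lg zg far pa qb.
- by rewrite (moved_base m) adj_sym (frame_adj _ _ xf).
- by rewrite (moved_row m) // (frame_adj2 _ _ _ _ xf) eqxx; neq_simpl.
- by rewrite (moved_col m) // (frame_adj2 _ _ _ _ xf) eqxx; neq_simpl.
have [_ _ [y xy hy]] : special x f a k p b l q.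
  by apply/(special_rows23 xf)/(special_swap_cols xf).
have [nxy axy _] := at2P xy.
have ey : y = g k l.
  by apply: (moved_corner xf m) => //; rewrite hy /hexagon !eqxx ?orbT.
have := hy p q; rewrite ey adj_sym H /hexagon !eqxx orbT /= !orbT.
move: u1 u2; rewrite !uniq3P => /and3P[u1 u2 u3] /and3P[v1 v2 v3].
rewrite !(eq_sym k) !(eq_sym l) (negPf ak) (negPf pk) (negPf ql) /=.
by case/andP=> /eqP <- /eqP <-.
Qed.

Lemma moved_special x f g a p k b q l : frame x f -> moved a b x f g ->
  special x f a p k b q l -> special (f a b) g a p k b q l.
Proof.
move=> xf m s; have [far h] := special_moved xf m s.
by case: s => u1 u2 _; split=> //; exists (f p q).
Qed.

(* [f a b] and [y] are adjacent and both at distance 2 from [f k q'], so they have a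
   common neighbour with it; its position in the frame at [f a b] forces [k' = p]. *)
Lemma special_row_through x f a p k b q l q' : frame x f ->
  special x f a p k b q l -> b != q' -> exists l', special x f a p k b q' l'.
Proof.
move=> xf s bq'; have [[ap ak pk] [bq bl ql]] := special_neq s.
have [Eq|q'q] := eqVneq q' q; first by exists l; rewrite Eq.
have [El|q'l] := eqVneq q' l; first by exists q; rewrite El; apply: special_swap_cols.
have [k' [l' s']] := special_exists xf ak bq'.
suff e : k' = p by exists l'; subst k'; apply: special_rows23.
have [[_ ak' kk'] [_ bl' ql']] := special_neq s'.
have [g m] := moved_exists lg a b xf; have zg := moved_frame m.
have [far2 h2] := special_moved xf m s'.
case: (s) => _ _ [y xy hy]; have [nxy axy _] := at2P xy.
have [hab haq hpb hpl [hkq hkl]] := hexagonE a p k b q l.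
have ey : y = g p q by apply: (moved_corner xf m); rewrite ?hy // eq_sym.
have far : at2 (f k q') y.
  apply: (@at2I _ _ _ (f k q)).
  - by apply: contraNneq axy => <-; exact: frame_adj xf.
  - by rewrite adj_sym hy /hexagon eqxx; neq_simpl.
  - by rewrite (frame_adj2 _ _ _ _ xf) eqxx; neq_simpl.
  - by rewrite hy.
have zy : adj (f a b) y by rewrite ey (frame_adj _ _ zg).
have [|v [_ [/andP[v1 _] /andP[v2 _] /andP[v3 _] _]]] := at2_pair _ far zy.
  by rewrite at2_sym.
have [i [j ev]] := frame_ex zg v2.
move: v1 v3; rewrite ev h2 ey (frame_adj2 _ _ _ _ zg).
have lq : l' != q.
  apply/negP => /eqP E; subst l'.
  have := special_unique xf (special_swap_cols xf s') (special_rows23 xf s).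
  by case=> _ /eqP; rewrite (negPf q'l).
rewrite /hexagon; clear -ap pk bq q'q lq.
by eqcases.
Qed.

Lemma special_row x f a p k b q l b' q' : frame x f ->
  special x f a p k b q l -> b' != q' -> exists l', special x f a p k b' q' l'.
Proof.
move=> xf s bq'; have [E|bb'] := eqVneq b b'.
  by subst b'; apply: special_row_through s _.
case: (special_row_through xf s bb') => l' /(special_cols12 xf) s'.
by apply: special_row_through s' _.
Qed.

Definition tri x f a p k := exists b q l, special x f a p k b q l.

Lemma tri_neq x f a p k : tri x f a p k -> [/\ a != p, a != k & p != k].
Proof. by case=> b [q [l /special_neq[]]]. Qed.

Lemma tri12 x f a p k : frame x f -> tri x f a p k -> tri x f p a k.
Proof. by move=> xf [b [q [l /(special_rows12 xf) s]]]; exists b, q, l. Qed.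

Lemma tri23 x f a p k : frame x f -> tri x f a p k -> tri x f a k p.
Proof. by move=> xf [b [q [l /(special_rows23 xf) s]]]; exists b, q, l. Qed.

Lemma tri_special x f a p k b q : frame x f -> tri x f a p k -> b != q ->
  exists l, special x f a p k b q l.
Proof. by move=> xf [b' [q' [l' s]]]; apply: special_row s. Qed.

Lemma tri_unique x f a p k k' : frame x f -> tri x f a p k -> tri x f a p k' -> k = k'.
Proof.
move=> xf [b [q [l s]]] t; have [_ [bq _ _]] := special_neq s.
have [l' s'] := tri_special xf t bq.
by have [] := special_unique xf s s'.
Qed.

Lemma tri_exists x f a p : frame x f -> a != p -> exists k, tri x f a p k.
Proof.
move=> xf ap; have /card_gt0P[b _] : 0 < #|J| by apply: leq_trans (lg_cols lg).
have [q qb] := other_col lg b; rewrite eq_sym in qb.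
by have [k [l s]] := special_exists xf ap qb; exists k, b, q, l.
Qed.

Lemma tri_moved x f g a p k b : frame x f -> moved a b x f g ->
  tri x f a p k -> tri (f a b) g a p k.
Proof.
move=> xf m t; have [q qb] := other_col lg b; rewrite eq_sym in qb.
by have [l s] := tri_special xf t qb; exists b, q, l; apply: moved_special s.
Qed.

Lemma tri_two_points x f (a k s p q r i i' : I) : frame x f -> tri x f p q r -> tri x f a k s ->
  i != i' -> i \in [:: p; q; r] -> i' \in [:: p; q; r] ->
  i \in [:: a; k; s] -> i' \in [:: a; k; s] ->
  a \in [:: p; q; r].
Proof.
move=> xf.
have third (u v w : I) : tri x f u v w -> i != i' -> i \in [:: u; v; w] -> i' \in [:: u; v; w] ->
    exists2 c, tri x f i i' c & [:: u; v; w] =i [:: i; i'; c].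
  move=> t ne; rewrite !inE => /or3P[] /eqP Ei /or3P[] /eqP Ei'; subst i i';
    rewrite ?eqxx // in ne.
  - by exists w.
  - by exists v; [exact: tri23 xf t|move=> h; rewrite !inE; do !case: eqP].
  - by exists w; [exact: tri12 xf t|move=> h; rewrite !inE; do !case: eqP].
  - by exists u; [exact: tri23 xf (tri12 xf t)|move=> h; rewrite !inE; do !case: eqP].
  - by exists v; [exact: tri12 xf (tri23 xf t)|move=> h; rewrite !inE; do !case: eqP].
  - by exists u; [exact: tri12 xf (tri23 xf (tri12 xf t))|move=> h; rewrite !inE; do !case: eqP].
move=> t t' ne m1 m2 m3 m4.
have [c tc ->] := third _ _ _ t ne m1 m2.
have [c' tc' Ec'] := third _ _ _ t' ne m3 m4.
by rewrite (tri_unique xf tc tc') -Ec' mem_head.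
Qed.

(* The witness [w] of the line [p, q, k'] at [f a b] and the vertex [g k' q0] are
   adjacent and both at distance 2 from [x], so their hexagons at [x] share an edge,
   which can only lie in the row [r]. *)
Lemma moved_tri x f g (a p q r k : I) b : frame x f -> moved a b x f g ->
  tri x f p q r -> a \notin [:: p; q; r] -> tri x f a r k -> tri (f a b) g p q k.
Proof.
move=> xf m t anot tk; have zg := moved_frame m.
have [pq pr qr] := tri_neq t; have [_ _ rk] := tri_neq tk.
move: (anot); rewrite !inE !negb_or => /and3P[ap aq ar].
have [k' t'] := tri_exists zg pq; have [_ pk' qk'] := tri_neq t'.
suff ts : tri x f a r k' by rewrite (tri_unique xf tk ts).
have [q0 q0b] := other_col lg b.
have ak' : a != k'.
  apply/eqP => E; subst k'; have [c tc] := tri_exists xf ap.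
  have := tri_moved xf m tc; move/(tri12 zg)/(tri23 zg) => tc'.
  have := tri_unique zg (tri23 zg t') (tri23 zg tc'); move=> E; subst c.
  have := tri_unique xf t (tri23 xf (tri12 xf tc)) => E; subst r.
  by rewrite eqxx in ar.
rewrite eq_sym in q0b.
have [w' [u1 u2 [w zw hw]]] := tri_special zg t' q0b.
move: u1 u2; rewrite !uniq3P => /and3P[u1 u2 u3] /and3P[v1 v2 v3].
have [pa qa k'a] : [/\ p != a, q != a & k' != a] by rewrite !(eq_sym _ a).
have wpb : adj w (f p b) by rewrite -(moved_row m pa) hw /hexagon !eqxx.
have wqb : adj w (f q b) by rewrite -(moved_row m qa) hw /hexagon !eqxx orbT.
have axw : ~~ adj x w.
  by rewrite adj_sym -(moved_base m) hw /hexagon; neq_simpl.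
have xw : at2 x w.
  apply: at2I axw (frame_adj p b xf) wpb.
  have [_ azw _] := at2P zw; apply: contraNneq azw => <-.
  by rewrite adj_sym (frame_adj _ _ xf).
have [nxw _ _] := at2P xw.
have [_ [c [_ cb _ rowp]]] := mates lg xf nxw axw wpb.
have [||r' [c' [s1 s2 Hw]]] := at2_hexagon lg xf xw _ cb wpb wqb _.
- by rewrite eq_sym.
- by rewrite rowp eqxx orbT.
have sp : special x f p q r' b c c' by split=> //; exists w.
have tr : tri x f p q r' by exists b, c, c'.
have E := tri_unique xf t tr; subst r'; clear tr.
have q0b' : q0 != b by rewrite eq_sym.
have [y1 y2 y3] := moved_corner_adj xf m k'a q0b'.
have xy := moved_at2 xf m k'a q0b'.
have [s [d [r1 r2 Hy]]] := at2_hexagon lg xf xy k'a q0b' y1 y2 y3.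
have ts : tri x f a k' s by exists b, q0, d; split=> //; exists (g k' q0).
have wy : adj w (g k' q0) by rewrite hw /hexagon !eqxx !orbT.
have [c1 [c2 [/andP[x1 x2] /andP[w1 w2] /andP[z1 z2] c12]]] := at2_pair xw xy wy.
have [i [j e1]] := frame_ex xf x1; have [i' [j' e2]] := frame_ex xf x2; subst c1 c2.
move: w1 w2 z1 z2 c12; rewrite !Hw !Hy (frame_adj2 _ _ _ _ xf).
have [Ei|ii'] := eqVneq i i'; last first.
  have on3 (h1 h2 h3 h : I) (g1 g2 g3 g' : J) :
      hexagon h1 h2 h3 g1 g2 g3 h g' -> h \in [:: h1; h2; h3].
    by rewrite /hexagon !inE => /or3P[]/andP[-> _]; rewrite ?orbT.
  move=> /on3 w1 /on3 w2 /on3 z1 /on3 z2 _.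
  by rewrite (tri_two_points xf t ts ii' w1 w2 z1 z2) in anot.
subst i'; move=> w1 w2 z1 z2 jj'.
suff /eqP E : s == r by subst s; apply: tri23.
have [[ak _ ks] [bq0 bd q0d]] : [/\ a != k', a != s & k' != s] /\ [/\ b != q0, b != d & q0 != d].
  by move: r1 r2; rewrite !uniq3P => /and3P[-> -> ->] /and3P[-> -> ->].
move: s1 s2; rewrite !uniq3P => /and3P[_ _ _] /and3P[s1 s2 s3].
move: w1 w2 z1 z2 jj'; rewrite /hexagon; clear -ap aq ar u1 u2 u3 pr qr s1 s2 s3 bq0 q0d ak ks bd.
by eqcases.
Qed.

End Special.

Lemma special_flip (G : sgraph) (I J : finType) x (f : I -> J -> G) a p k b q l :
  special x f a p k b q l -> special x (flip f) b q l a p k.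
Proof.
case=> u1 u2 [y xy h]; split=> //; exists y => // j i.
rewrite /flip h /hexagon.
by case: (i == a); case: (i == p); case: (i == k); case: (j == b); case: (j == q); case: (j == l).
Qed.

Lemma tri_assoc (G : sgraph) (I J : finType) x (f : I -> J -> G) (a p q r k s : I) :
    locally_grid G I J -> frame x f -> tri x f p q r -> a \notin [:: p; q; r] ->
    tri x f a r k -> tri x f k q s ->
  tri x f a p s.
Proof.
move=> lg xf t anot t1 t2.
have /card_gt0P[b _] : 0 < #|J| by apply: leq_trans (lg_cols lg).
have [g m] := moved_exists lg a b xf; have zg := moved_frame m.
have [pq pr qr] := tri_neq t; have [ar ak rk] := tri_neq t1; have [kq ks qs] := tri_neq t2.
have aq : a != q by move: anot; rewrite !inE !negb_or => /and3P[].
have as_ : a != s.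
  apply: contraNneq qr => E; subst s; apply/eqP.
  by apply: (tri_unique lg xf (tri12 lg xf (tri23 lg xf t2)) (tri23 lg xf t1)).
have [k' t3] := tri_exists lg xf as_.
have t4 : tri (f a b) g k q k' by apply: moved_tri m t2 _ t3 => //; rewrite !inE; neq_simpl.
have t5 : tri (f a b) g k q p.
  by apply/(tri12 lg zg)/(tri23 lg zg)/(tri12 lg zg); apply: moved_tri m t anot t1.
rewrite (tri_unique lg zg t4 t5) in t3.
exact: (tri23 lg xf t3).
Qed.

(** * Rows as vectors over F_2 *)

Lemma elementary_abelian_coordinates (X : finType) (e : X) (op : X -> X -> X) :
    associative op -> commutative op -> left_id e op -> (forall x, op x x = e) ->
  exists d (h : 'rV['F_2]_d -> X), bijective h /\ forall u v, h (u + v)%R = op (h u) (h v).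
Proof.
move=> opA opC op1 opK.
have F2 (c : 'F_2) : c = 0%R \/ c = 1%R.
  by case: c => -[|[|//]] ?; [left|right]; apply: val_inj.
have grow N d (h : 'rV['F_2]_d -> X) : injective h ->
    (forall u v, h (u + v)%R = op (h u) (h v)) -> #|X| - 2 ^ d < N ->
    exists d (h : 'rV['F_2]_d -> X), bijective h /\ forall u v, h (u + v)%R = op (h u) (h v).
  elim: N d h => // N IH d h hi hD hN.
  have h0 : h 0%R = e by rewrite -(addr0 0%R) hD opK.
  have [full|/subsetPn[x _ xh]] := boolP (X \subset codom h).
    exists d, h; split=> //; apply: inj_card_bij => //.
    by rewrite -(card_codom hi); apply: subset_leq_card.
  have cd : 2 ^ d < #|X|.
    have <- : #|codom h| = 2 ^ d by rewrite card_codom // card_mx card_Fp // mul1n.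
    by apply: proper_card; apply/properP; split; [apply/subsetP|exists x].
  pose c (w : 'rV['F_2]_(1 + d)) := w ord0 (lshift d ord0).
  pose h' w := op (if c w == 0%R then e else x) (h (rsubmx w)).
  have opCA a b g : op a (op b g) = op b (op a g) by rewrite opA (opC a) -opA.
  have h'D u v : h' (u + v)%R = op (h' u) (h' v).
    have cD (b b' : 'F_2) : (if (b + b')%R == 0%R then e else x)
        = op (if b == 0%R then e else x) (if b' == 0%R then e else x).
      have [->|->] := F2 b; have [->|->] := F2 b'.
      - by rewrite addr0 eqxx op1.
      - by rewrite add0r eqxx op1.
      - by rewrite addr0 eqxx opC op1.
      - by rewrite /= opK.
    rewrite /h' linearD hD /= /c mxE cD -!opA; congr (op _ _); exact: opCA.
  apply: (IH (1 + d) h') => //; last first.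
    by rewrite -ltnS; apply: leq_trans hN; rewrite expnD ltnS ltn_sub2l // ltn_Pmull ?expn_gt0.
  move=> u v E.
  have : h' (u + v)%R = e by rewrite h'D E opK.
  have uv : (u + v = 0 -> u = v)%R.
    move/eqP; rewrite addr_eq0 => /eqP->; apply/rowP => i; rewrite mxE.
    by have [->|->] := F2 (v ord0 i); [rewrite oppr0|apply: val_inj].
  move=> H; apply: uv; move: (u + v)%R H => w; rewrite /h'.
  case: eqP => [c0|_] H.
    rewrite op1 -h0 in H; move/hi in H; apply/rowP => i; rewrite mxE.
    case: (split_ordP i) => j ->; first by rewrite [j]ord1.
    by have /rowP/(_ j) := H; rewrite !mxE.
  case/negP: xh; suff -> : x = h (rsubmx w) by exact: codom_f.
  by rewrite -[LHS]op1 opC -(opK (h (rsubmx w))) opA H op1.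
apply: (grow #|X|.+1 0 (fun _ => e)).
- by move=> u v _; rewrite (thinmx0 u) (thinmx0 v).
- by move=> u v; rewrite op1.
- by rewrite ltnS leq_subr.
Qed.

Definition sums_to (I : finType) (V : zmodType) (mu : I -> V) (t : I -> I -> I -> Prop) :=
  forall a p k, a != p -> mu k = (mu a + mu p)%R -> t a p k.

Record labelling (I : finType) (V : zmodType) (mu : I -> V) : Prop := Labelling {
  lab_inj : injective mu;
  lab_neq0 : forall i, mu i != 0%R;
  lab_onto : forall v, v != 0%R -> exists i, mu i = v }.

Lemma tri_labelling (G : sgraph) (I J : finType) (x : G) (f : I -> J -> G) :
    locally_grid G I J -> frame x f ->
  exists d (mu : I -> 'rV['F_2]_d), labelling mu /\ sums_to mu (tri x f).
Proof.
move=> lg xf.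
have [third thirdP] : exists th : I -> I -> I, forall a p, a != p -> tri x f a p (th a p).
  have ex (a p : I) : exists k, a != p -> tri x f a p k.
    have [->|ap] := eqVneq a p; first by exists p.
    by have [k t] := tri_exists lg xf ap; exists k.
  have /fin_all_exists[th thP] : forall a : I, exists g : I -> I,
      forall p, a != p -> tri x f a p (g p).
    by move=> a; apply: fin_all_exists (ex a).
  by exists th.
have eqth a p k : tri x f a p k -> third a p = k.
  by move=> t; have [ap _ _] := tri_neq t; apply: (tri_unique lg xf (thirdP _ _ ap) t).
have thC a p : a != p -> third a p = third p a.
  by move=> ap; apply: eqth; apply: (tri12 lg xf); apply: thirdP; rewrite eq_sym.
have thK a p : a != p -> third a (third a p) = p.
  by move=> ap; apply: eqth; apply/(tri23 lg xf)/thirdP.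
have thN a p : a != p -> (a != third a p) /\ (p != third a p).
  by move=> ap; have [_] := tri_neq (thirdP _ _ ap).
pose op (u v : option I) := match u, v with
  | None, _ => v | _, None => u
  | Some a, Some p => if a == p then None else Some (third a p) end.
have opC : commutative op.
  by move=> [a|] [p|] //=; rewrite (eq_sym p); case: eqVneq => //= ap; rewrite thC.
have opK u : op u u = None by case: u => //= a; rewrite eqxx.
have opKK a p : op (Some a) (op (Some a) (Some p)) = Some p.
  rewrite /=; case: (eqVneq a p) => [->|ap] //=.
  by have [/negPf-> _] := thN _ _ ap; rewrite thK.
have opN u : op u None = u by case: u.
have opA : associative op.
  move=> [a|] [p|] [q|]; rewrite ?opN //.
  have [->|ap] := eqVneq a p; first by rewrite opK opKK.
  have [->|pq] := eqVneq p q.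
    by rewrite opK opN [RHS]opC (opC (Some a)) opKK.
  have [->|aq] := eqVneq a q.
    by rewrite [RHS]opC (opC (Some p)).
  rewrite /= (negPf ap) (negPf pq) /=.
  have [E|aNpq] := eqVneq a (third p q).
    by rewrite E thC ?thK ?eqxx // eq_sym; have [] := thN _ _ pq.
  have N : a \notin [:: p; q; third p q] by rewrite !inE; neq_simpl.
  have tk := thirdP _ _ aNpq; have [_ _ rk] := tri_neq tk.
  set k := third a (third p q) in tk rk *.
  have kq : k != q.
    apply: contraNneq ap => E; rewrite E in tk.
    apply/eqP; apply: (tri_unique lg xf (tri23 lg xf (tri12 lg xf (tri23 lg xf tk)))).
    exact: (tri23 lg xf (tri12 lg xf (thirdP _ _ pq))).
  have ts := thirdP _ _ kq.
  have := tri_assoc lg xf (thirdP _ _ pq) N tk ts => /eqth E.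
  have [_ _ qs] := tri_neq ts.
  rewrite E eq_sym (negPf qs); congr Some; apply/esym/eqth.
  by apply/(tri12 lg xf)/(tri23 lg xf)/(tri12 lg xf).
have [d [h [[h' hK h'K] hD]]] :=
  elementary_abelian_coordinates opA opC (fun u => erefl : op None u = u) opK.
have h0 : h 0%R = None by rewrite -(addr0 0%R) hD opK.
exists d, (fun i => h' (Some i)); split; [split|].
- by move=> i j /(can_inj h'K)[].
- by move=> i; apply/eqP => E; have := h'K (Some i); rewrite E h0.
- move=> v v0; case E : (h v) => [i|]; first by exists i; rewrite -E hK.
  by case/eqP: v0; rewrite -(hK v) E -h0 hK.
- move=> a p k ap E; have := congr1 h E; rewrite hD !h'K /= (negPf ap).
  by case=> ->; apply: thirdP.
Qed.

Section Good.
Variables (G : sgraph) (I J : finType).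
Variables (V W : zmodType) (mu : I -> V) (nu : J -> W).
Hypotheses (V2 : forall v : V, (v + v = 0)%R) (W2 : forall w : W, (w + w = 0)%R).
Hypotheses (lg : locally_grid G I J) (labI : labelling mu) (labJ : labelling nu).
Implicit Types (a p k i : I) (b q l j : J) (x y z w v : G) (f g : I -> J -> G).

Definition good x f := [/\ frame x f, sums_to mu (tri x f) & sums_to nu (tri x (flip f))].

Lemma good_special x f a p k b q l : good x f -> a != p -> b != q ->
  mu k = (mu a + mu p)%R -> nu l = (nu b + nu q)%R -> special x f a p k b q l.
Proof.
case=> xf hI hJ ap bq ek el.
have [l' s] := tri_special lg xf (hI _ _ _ ap ek) bq.
have t : tri x (flip f) b q l' by exists a, p, k; apply: special_flip.
by rewrite (tri_unique (locally_grid_flip lg) (frame_flip xf) (hJ _ _ _ bq el) t).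
Qed.
End Good.

Section Twist.
Variables (I : finType) (V : zmodType) (mu : I -> V).
Hypotheses (V2 : forall v : V, (v + v = 0)%R) (lab : labelling mu).

Definition label (i0 : I) (v : V) := odflt i0 [pick i | mu i == v].

Lemma labelE i0 v : v != 0%R -> mu (label i0 v) = v.
Proof.
move=> v0; rewrite /label; case: pickP => [i /eqP//|no].
by have [i E] := lab_onto lab v0; have := no i; rewrite E eqxx.
Qed.

Definition twist a p := if p == a then a else label a (mu a + mu p)%R.

Lemma oppV (v : V) : (- v = v)%R.
Proof. by apply/eqP; rewrite eq_sym -addr_eq0 V2. Qed.

Lemma addVK (u v : V) : (u + (u + v) = v)%R.
Proof. by rewrite addrA V2 add0r. Qed.

Lemma twist_id a : twist a a = a. Proof. by rewrite /twist eqxx. Qed.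

Lemma twistE a p : p != a -> mu (twist a p) = (mu a + mu p)%R.
Proof.
move=> pa; rewrite /twist (negPf pa) labelE //.
by rewrite addr_eq0 oppV (inj_eq (lab_inj lab)) eq_sym.
Qed.

Lemma twist_neq a p : p != a -> twist a p != a.
Proof.
move=> pa; apply/eqP => /(congr1 mu); rewrite twistE // => /eqP.
by rewrite -subr_eq0 addrC addKr; have /negPf-> := lab_neq0 lab p.
Qed.

Lemma twistP a p k : p != a -> mu k = (mu a + mu p)%R -> twist a p = k.
Proof. by move=> pa E; apply: (lab_inj lab); rewrite twistE. Qed.

Lemma twistK a : involutive (twist a).
Proof.
move=> p; have [->|pa] := eqVneq p a; first by rewrite !twist_id.
by apply: twistP; [exact: twist_neq|rewrite twistE // addVK].
Qed.

End Twist.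

(** * Transport of coordinates *)

Lemma frame_ext (G : sgraph) (I J : finType) (z : G) (g h : I -> J -> G) a b :
    frame z g -> frame z h -> g a b = h a b ->
    (forall p, p != a -> g p b = h p b) -> (forall q, q != b -> g a q = h a q) ->
  forall i j, g i j = h i j.
Proof.
move=> zg zh e ep eq i j.
have [->|ia] := eqVneq i a; first by have [->|/eq] := eqVneq j b.
have [->|jb] := eqVneq j b; first exact: ep.
have [|i' [j' E]] := frame_ex zh (v := g i j); first exact: frame_adj zg.
have E1 : (i' == i) (+) (j' == b).
  by rewrite -(frame_adj2 _ _ _ _ zh) -ep // -E (frame_adj2 _ _ _ _ zg) eqxx; neq_simpl.
have E2 : (i' == a) (+) (j' == j).
  by rewrite -(frame_adj2 _ _ _ _ zh) -eq // -E (frame_adj2 _ _ _ _ zg) eqxx; neq_simpl.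
have E3 : (i' == a) (+) (j' == b) = false.
  by rewrite -(frame_adj2 _ _ _ _ zh) -e // -E (frame_adj2 _ _ _ _ zg); neq_simpl.
have E4 : (i' == a) && (j' == b) = false.
  by rewrite -(frame_eq _ _ _ _ zh) -e // -E (frame_eq _ _ _ _ zg); neq_simpl.
rewrite E; move: E1 E2 E3 E4.
have [_|_] := eqVneq i' a; have [_|_] //= := eqVneq j' b.
by rewrite addbF => /eqP-> /eqP->.
Qed.

Lemma special_reindex (G : sgraph) (I J : finType) (z : G) (g : I -> J -> G)
    (s : I -> I) (t : J -> J) a p k b q l : injective s -> injective t ->
    special z g (s a) (s p) (s k) (t b) (t q) (t l) ->
  special z (fun i j => g (s i) (t j)) a p k b q l.
Proof.
move=> si ti [u1 u2 [y zy hy]]; split.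
- by rewrite -(map_inj_uniq si).
- by rewrite -(map_inj_uniq ti).
by exists y => // i j; rewrite hy /hexagon !(inj_eq si) !(inj_eq ti).
Qed.

Lemma tri_reindex (G : sgraph) (I J : finType) (z : G) (g : I -> J -> G)
    (s : I -> I) (t : J -> J) a p k : injective s -> involutive t ->
    tri z g (s a) (s p) (s k) ->
  tri z (fun i j => g (s i) (t j)) a p k.
Proof.
move=> si ti [b [q [l h]]]; exists (t b), (t q), (t l).
by apply: special_reindex => //; [exact: inv_inj|rewrite !ti].
Qed.

Definition twist_frame (G : sgraph) (I J : finType) (V W : zmodType)
  (mu : I -> V) (nu : J -> W) a b (g : I -> J -> G) i j :=
  g (twist mu a i) (twist nu b j).

(* In affine coordinates centred at [a], the sum of [p] and [q] is [a + p + q]. *)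
Lemma sums_to_moved (G : sgraph) (I J : finType) (V W : zmodType)
    (mu : I -> V) (nu : J -> W) a b x (f g : I -> J -> G) :
    (forall v : V, (v + v = 0)%R) -> (forall w : W, (w + w = 0)%R) ->
    locally_grid G I J -> labelling mu -> labelling nu ->
    frame x f -> moved a b x f g -> sums_to mu (tri x f) ->
  sums_to mu (tri (f a b) (twist_frame mu nu a b g)).
Proof.
move=> V2 W2 lg labI labJ xf m hI p q k pq ek; have zg := moved_frame m.
apply: tri_reindex; [exact: inv_inj (twistK V2 labI a)|exact: twistK W2 labJ b|].
have [Ep|pa] := eqVneq p a.
  subst p; rewrite twist_id (twistP V2 labI (k := k)) 1?eq_sym //.
  have ak : a != k.
    apply/eqP => E; move/eqP: ek; rewrite E -subr_eq0 opprD addNKr oppr_eq0.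
    by have /negPf-> := lab_neq0 labI q.
  rewrite (twistP V2 labI (k := q)) 1?eq_sym //; last by rewrite ek addVK.
  by apply: (tri_moved lg xf m); apply: hI; rewrite // ek addVK.
have [Eq|qa] := eqVneq q a.
  subst q; rewrite twist_id (twistP V2 labI (k := k)) //; last by rewrite addrC.
  have ak : a != k.
    apply/eqP => E; move/eqP: ek; rewrite E addrC -subr_eq0 opprD addNKr oppr_eq0.
    by have /negPf-> := lab_neq0 labI p.
  rewrite (twistP V2 labI (k := p)) 1?eq_sym //; last by rewrite ek addrC -addrA V2 addr0.
  apply/(tri12 lg zg)/(tri_moved lg xf m)/hI; first exact: ak.
  by rewrite ek addrC -addrA V2 addr0.
have [Ek|ka] := eqVneq k a.
  subst k; rewrite twist_id (twistP V2 labI (k := q)) //; last first.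
    by rewrite ek addrC addVK.
  rewrite (twistP V2 labI (k := p)) //; last by rewrite ek -addrA V2 addr0.
  apply/(tri12 lg zg)/(tri23 lg zg)/(tri12 lg zg)/(tri_moved lg xf m).
  by apply: hI; rewrite 1?eq_sym // ek addrC addVK.
have E : mu k = (mu (twist mu a p) + mu (twist mu a q))%R.
  by rewrite !twistE // addrACA V2 add0r.
have npq : twist mu a p != twist mu a q by rewrite (inj_eq (inv_inj (twistK V2 labI a))).
apply: (moved_tri lg xf m (hI _ _ _ npq E)).
- rewrite !inE; have := twist_neq V2 labI pa; have := twist_neq V2 labI qa.
  by rewrite !(eq_sym a) (negPf ka) => /negPf-> /negPf->.
- by apply: hI; rewrite 1?eq_sym // twistE.
Qed.

Definition step (G : sgraph) (I J : finType) (V W : zmodType)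
    (mu : I -> V) (nu : J -> W) a b (x : G) (f g : I -> J -> G) :=
  [/\ frame (f a b) g, g a b = x,
     forall p, p != a -> g p b = f (twist mu a p) b
   & forall q, q != b -> g a q = f a (twist nu b q)].

Lemma step_flip (G : sgraph) (I J : finType) (V W : zmodType)
    (mu : I -> V) (nu : J -> W) a b (x : G) (f g : I -> J -> G) :
  step mu nu a b x f g -> step nu mu b a x (flip f) (flip g).
Proof. by case=> [/frame_flip gf gx gb ga]; split. Qed.

Lemma good_flip (G : sgraph) (I J : finType) (V W : zmodType)
    (mu : I -> V) (nu : J -> W) (x : G) (f : I -> J -> G) :
  good mu nu x f -> good nu mu x (flip f).
Proof. by case=> /frame_flip xf hI hJ; split. Qed.

Section Step.
Variables (G : sgraph) (I J : finType).
Variables (V W : zmodType) (mu : I -> V) (nu : J -> W).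
Hypotheses (V2 : forall v : V, (v + v = 0)%R) (W2 : forall w : W, (w + w = 0)%R).
Hypotheses (lg : locally_grid G I J) (labI : labelling mu) (labJ : labelling nu).
Implicit Types (a p k i : I) (b q l j : J) (x y z : G) (f g h : I -> J -> G).

Lemma step_exists x f a b : good mu nu x f ->
  exists2 g, step mu nu a b x f g & good mu nu (f a b) g.
Proof.
case=> xf hI hJ; have [g m] := moved_exists lg a b xf; have zg := moved_frame m.
have zt : frame (f a b) (twist_frame mu nu a b g).
  by apply: frame_reindex zg; apply: inv_inj; [exact: twistK|exact: twistK].
exists (twist_frame mu nu a b g); split=> //.
- by rewrite /twist_frame !twist_id (moved_base m).
- by move=> p pa; rewrite /twist_frame twist_id (moved_row m) // twist_neq.
- by move=> q qb; rewrite /twist_frame twist_id (moved_col m) // twist_neq.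
- exact: (sums_to_moved V2 W2 lg labI labJ xf m hI).
- exact: (sums_to_moved W2 V2 (locally_grid_flip lg) labJ labI (frame_flip xf) (moved_flip m) hJ).
Qed.

Lemma step_invol x f g h a b : frame x f -> step mu nu a b x f g ->
  step mu nu a b (f a b) g h -> forall i j, h i j = f i j.
Proof.
move=> xf [g1 g2 g3 g4] [h1 h2 h3 h4]; rewrite g2 in h1.
apply: (frame_ext h1 xf (a := a) (b := b)) => //.
- by move=> p pa; rewrite h3 // g3 ?twistK // twist_neq.
- by move=> q qb; rewrite h4 // g4 ?twistK // twist_neq.
Qed.

Lemma step_add x f g h t a a' c b : good mu nu x f -> a != a' ->
    mu c = (mu a + mu a')%R ->
    step mu nu a b x f g -> step mu nu a' b (f a b) g h -> step mu nu c b x f t ->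
  forall i j, t i j = h i j.
Proof.
move=> gf aa' ec [g1 g2 g3 g4] [h1 h2 h3 h4] [t1 t2 t3 t4].
have xf : frame x f by case: gf.
have a'a : a' != a by rewrite eq_sym.
have Ec : twist mu a a' = c by apply: twistP.
have ca : c != a by rewrite -Ec twist_neq.
have ca' : c != a'.
  apply/eqP => E; move/eqP: ec; rewrite E addrC -subr_eq0 opprD addNKr oppr_eq0.
  by have /negPf-> := lab_neq0 labI a.
rewrite g3 // Ec in h1.
have hcb : h c b = x.
  by rewrite h3 // (twistP V2 labI (k := a)) // ec addrCA V2 addr0.
apply: (frame_ext t1 h1 (a := c) (b := b)); first by rewrite t2 hcb.
- move=> p pc; rewrite t3 //; have [->|pa'] := eqVneq p a'.
    by rewrite h2 (twistP V2 labI (k := a)) 1?eq_sym // ec -addrA V2 addr0.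
  have na : twist mu a' p != a.
    apply/eqP => E; case/eqP: pc; rewrite -Ec -[p](twistK V2 labI a') E.
    by apply: (lab_inj labI); rewrite !twistE // addrC.
  rewrite h3 // g3 //; congr (f _ b); apply: (lab_inj labI).
  by rewrite !twistE // ec addrA.
move=> q qb; pose l := twist nu b q; rewrite t4 // -/l.
have lb : l != b by apply: twist_neq.
have y1 : at2 x (g a' l).
  apply: (at2I (v := f a b)).
  - by rewrite -g2 (frame_eq _ _ _ _ g1); neq_simpl.
  - by rewrite -g2 (frame_adj2 _ _ _ _ g1); neq_simpl.
  - exact: frame_adj xf.
  - by rewrite adj_sym; exact: frame_adj g1.
have gaq : g a l = f a q by rewrite g4 // /l twistK.
have gab : g a' b = f c b by rewrite g3 // Ec.
have [nxy axy _] := at2P y1.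
have S : special x f a c a' b q l.
  apply: (good_special lg gf); rewrite 1?eq_sym //.
  - by rewrite ec addVK.
  - by rewrite /l twistE.
case: S => _ _ [y /at2P[nxy' axy' _] hy].
have E : g a' l = y.
  apply: (corner_unique lg xf ca qb) => //; rewrite ?hy /hexagon ?eqxx ?orbT //.
  - by rewrite adj_sym; exact: frame_adj g1.
  - by rewrite -gab (frame_adj2 _ _ _ _ g1) eqxx; neq_simpl.
  - by rewrite -gaq (frame_adj2 _ _ _ _ g1) eqxx; neq_simpl.
have adjl : adj (f c l) (h a' q).
  by rewrite h4 // -/l E adj_sym hy /hexagon !eqxx !orbT.
have adjx : adj (f c l) x by rewrite adj_sym; exact: frame_adj xf.
have [|i [j e]] := frame_ex h1 (v := f c l).
  by rewrite (frame_adj2 _ _ _ _ xf) eqxx; neq_simpl.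
have ne : (i == a') && (j == b) = false.
  by rewrite -(frame_eq _ _ _ _ h1) -e h2 (frame_eq _ _ _ _ xf); neq_simpl.
rewrite e; move: adjl adjx ne; rewrite e -hcb !(frame_adj2 _ _ _ _ h1).
by clear -ca' qb; eqcases.
Qed.

End Step.

(** * The covering *)

Lemma mxF2_double m n (A : 'M['F_2]_(m, n)) : (A + A = 0)%R.
Proof.
by apply/matrixP => i j; rewrite !mxE; case: (A i j) => -[|[|//]] ?; apply: val_inj.
Qed.

Lemma mxF2_opp m n (A : 'M['F_2]_(m, n)) : (- A = A)%R.
Proof. by apply/eqP; rewrite eq_sym -addr_eq0 mxF2_double. Qed.

Section Development.
Variables (d e : nat) (S : Type) (P : S -> Prop).
Variable T : 'rV['F_2]_d -> 'rV['F_2]_e -> S -> S.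
Hypotheses (TP : forall u v s, P s -> P (T u v s))
  (T0l : forall v s, T 0%R v s = s) (T0r : forall u s, T u 0%R s = s)
  (TDl : forall u u' v s, P s -> T (u + u')%R v s = T u v (T u' v s))
  (TDr : forall u v v' s, P s -> T u (v + v')%R s = T u v (T u v' s)).

Lemma T_involutive u v s : P s -> T u v (T u v s) = s.
Proof. by move=> Ps; rewrite -TDl // mxF2_double T0l. Qed.

(* Expanding [T (u + u') (v + v')] in two ways shows that the action of a
   biadditive family is automatically commutative. *)
Lemma T_comm u v u' v' s : P s -> T u v (T u' v' s) = T u' v' (T u v s).
Proof.
move=> Ps; pose s0 := T u' v s; have Ps0 : P s0 by apply: TP.
have Es : T u' v s0 = s by apply: T_involutive.
have E : T u v' (T u v (T u' v' (T u' v s0))) = T u v' (T u' v' (T u v (T u' v s0))).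
  transitivity (T (u + u')%R (v' + v)%R s0).
    by rewrite TDl // (TDr u') // TDr //; do !apply: TP.
  by rewrite TDr // !TDl //; do !apply: TP.
rewrite Es in E; have := congr1 (T u v') E.
by rewrite !T_involutive //; do !apply: TP.
Qed.

Definition develop (r : seq 'I_d) (A : 'M['F_2]_(d, e)) (s : S) : S :=
  foldr (fun i => T (delta_mx 0%R i) (row i A)) s r.

Lemma develop_P r A s : P s -> P (develop r A s).
Proof. by move=> Ps; elim: r => //= i r; apply: TP. Qed.

Lemma develop_comm r A u v s : P s -> T u v (develop r A s) = develop r A (T u v s).
Proof.
move=> Ps; elim: r => //= i r IH.
by rewrite T_comm ?IH //; apply: develop_P.
Qed.

Lemma developD r A B s : P s ->
  develop r (A + B)%R s = develop r A (develop r B s).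
Proof.
move=> Ps; elim: r => //= i r ->.
rewrite linearD /= TDr; last by do !apply: develop_P.
by rewrite (develop_comm r A); last exact: develop_P.
Qed.

Lemma develop_rank1 r u v s : P s ->
  develop r (u^T *m v)%R s = T (\sum_(i <- r) u ord0 i *: delta_mx 0 i)%R v s.
Proof.
move=> Ps; elim: r => [|i r IH] /=; first by rewrite big_nil T0l.
rewrite big_cons TDl // IH.
have -> : row i (u^T *m v)%R = (u ord0 i *: v)%R.
  by apply/rowP => j; rewrite !mxE big_ord1 !mxE.
have [->|->] : u ord0 i = 0%R \/ u ord0 i = 1%R.
- by case: (u ord0 i) => -[|[|//]] ?; [left|right]; apply: val_inj.
- by rewrite !scale0r T0l T0r.
- by rewrite !scale1r.
Qed.

Lemma develop_step A u v s : P s ->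
  develop (index_enum 'I_d) (A + u^T *m v)%R s
  = T u v (develop (index_enum 'I_d) A s).
Proof.
move=> Ps; rewrite developD // develop_rank1 // -develop_comm //.
by congr T; rewrite [RHS]row_sum_delta.
Qed.

End Development.

Lemma rank1_factor (F : fieldType) m n (A : 'M[F]_(m, n)) : \rank A = 1 ->
  exists (u : 'rV_m) (v : 'rV_n), [/\ u != 0, v != 0 & A = u^T *m v]%R.
Proof.
move=> rA; have A0 : A != 0%R by rewrite -mxrank_eq0 rA.
have [u [v E]] : exists (u : 'rV_m) (v : 'rV_n), A = (u^T *m v)%R.
  exists (castmx (erefl m, rA) (col_base A))^T%R, (castmx (rA, erefl n) (row_base A)).
  by rewrite trmxK -[LHS]mulmx_base; case: _ / rA.
exists u, v; split=> //; apply: contraNneq A0 => E'; rewrite E E'.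
  by rewrite trmx0 mul0mx.
by rewrite mulmx0.
Qed.

Lemma rank_rank1 (F : fieldType) m n (u : 'rV[F]_m) (v : 'rV[F]_n) :
  (u != 0 -> v != 0 -> \rank (u^T *m v) = 1)%R.
Proof.
move=> u0 v0; rewrite mxrankMfree ?mxrank_tr ?rank_rV ?u0 //.
by rewrite /row_free rank_rV v0.
Qed.

Lemma labelling_card (I : finType) d (mu : I -> 'rV['F_2]_d) :
  labelling mu -> #|I|.+1 = 2 ^ d.
Proof.
move=> lab.
have <- : #|'rV['F_2]_d| = 2 ^ d by rewrite card_mx card_Fp // mul1n.
rewrite -(cardC (pred1 (0 : 'rV['F_2]_d)%R)) card1 add1n -(card_codom (lab_inj lab)).
congr _.+1; apply: eq_card => v; rewrite !inE.
apply/codomP/idP => [[i ->]|/(lab_onto lab)[i <-]]; last by exists i.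
exact: lab_neq0.
Qed.

Section Cover.
Variables (G : sgraph) (I J : finType) (d e : nat).
Variables (mu : I -> 'rV['F_2]_d) (nu : J -> 'rV['F_2]_e).
Hypotheses (lg : locally_grid G I J) (labI : labelling mu) (labJ : labelling nu).

Definition state : finType := (G * {ffun I * J -> G})%type.
(* Charts are stored as finite functions so that states form a finite type, over
   which transport maps can be chosen. *)
Definition chart (s : state) (i : I) (j : J) : G := s.2 (i, j).
Definition good_state (s : state) := good mu nu s.1 (chart s).

Lemma chart_ffun x (f : I -> J -> G) : chart (x, [ffun u => f u.1 u.2]) = f.
Proof.
by apply: functional_extensionality => i; apply: functional_extensionality => j;
  rewrite /chart ffunE.
Qed.

Lemma state_eq (s t : state) : s.1 = t.1 -> (forall i j, chart s i j = chart t i j) -> s = t.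
Proof.
by case: s t => [x f] [y g] /= -> E; congr pair; apply/ffunP => -[i j]; apply: E.
Qed.

Lemma step_states : exists T : I -> J -> state -> state, forall a b s, good_state s ->
  [/\ (T a b s).1 = chart s a b, good_state (T a b s)
    & step mu nu a b s.1 (chart s) (chart (T a b s))].
Proof.
have /fin_all_exists[T TP] : forall u : I * J * state, exists t : state, good_state u.2 ->
    [/\ t.1 = chart u.2 u.1.1 u.1.2, good_state t
      & step mu nu u.1.1 u.1.2 u.2.1 (chart u.2) (chart t)].
  move=> [[a b] s] /=; have [gs|] := classic (good_state s); last by exists s.
  have [g st gg] := step_exists (@mxF2_double 1 d) (@mxF2_double 1 e) lg labI labJ a b gs.
  exists (chart s a b, [ffun u => g u.1 u.2]) => _; split=> //.
  - by rewrite /good_state chart_ffun.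
  - by rewrite chart_ffun.
by exists (fun a b s => T (a, b, s)) => a b s /(TP (a, b, s)).
Qed.

Lemma action_exists : exists T : 'rV['F_2]_d -> 'rV['F_2]_e -> state -> state,
  [/\ forall u v s, good_state s -> good_state (T u v s),
      (forall v s, T 0%R v s = s) /\ (forall u s, T u 0%R s = s),
      forall u u' v s, good_state s -> T (u + u')%R v s = T u v (T u' v s),
      forall u v v' s, good_state s -> T u (v + v')%R s = T u v (T u v' s)
    & forall a b s, good_state s -> (T (mu a) (nu b) s).1 = chart s a b].
Proof.
have [T TP] := step_states.
have /card_gt0P[i0 _] : 0 < #|I| by apply: leq_trans (lg_rows lg).
have /card_gt0P[j0 _] : 0 < #|J| by apply: leq_trans (lg_cols lg).
have V2 := @mxF2_double 1 d; have W2 := @mxF2_double 1 e.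
pose act u v s := if (u == 0%R) || (v == 0%R) then s
  else T (label mu i0 u) (label nu j0 v) s.
have a0l v s : act 0%R v s = s by rewrite /act eqxx.
have a0r u s : act u 0%R s = s by rewrite /act eqxx orbT.
have actE a b s : act (mu a) (nu b) s = T a b s.
  rewrite /act (negPf (lab_neq0 labI a)) (negPf (lab_neq0 labJ b)) /=.
  by congr T; [apply: (lab_inj labI)|apply: (lab_inj labJ)]; rewrite labelE // lab_neq0.
have TT a b s : good_state s -> T a b (T a b s) = s.
  move=> gs; have [e1 g1 s1] := TP a b s gs; have [e2 g2 s2] := TP a b _ g1.
  have [sf _ _] := gs; rewrite e1 in s2.
  apply: state_eq; last exact: (step_invol V2 W2 labI labJ sf s1 s2).
  by rewrite e2; case: s1.
exists act; split=> //.
- move=> u v s gs; rewrite /act; case: ifP => // _.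
  by have [] := TP (label mu i0 u) (label nu j0 v) s gs.
- move=> u u' v s gs.
  have [->|v0] := eqVneq v 0%R; first by rewrite !a0r.
  have [->|u0] := eqVneq u 0%R; first by rewrite add0r a0l.
  have [->|u'0] := eqVneq u' 0%R; first by rewrite addr0 a0l.
  have [b <-] := lab_onto labJ v0; have [a ea] := lab_onto labI u0.
  have [a' ea'] := lab_onto labI u'0; subst u u'.
  have [<-|ne] := eqVneq a a'; first by rewrite V2 a0l !actE TT.
  have [c ec] : exists c, mu c = (mu a' + mu a)%R.
    apply: (lab_onto labI); rewrite addr_eq0 mxF2_opp (inj_eq (lab_inj labI)).
    by rewrite eq_sym.
  rewrite addrC -ec !actE.
  have [e1 g1 s1] := TP a' b s gs; have [e2 g2 s2] := TP a b _ g1.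
  have [e3 g3 s3] := TP c b s gs; rewrite e1 in s2.
  apply: state_eq; last first.
    by apply: (step_add V2 W2 lg labI labJ gs _ ec s1 s2 s3); rewrite eq_sym.
  rewrite e2 e3; case: s1 => _ _ -> //.
  by rewrite (twistP V2 labI (k := c)).
- move=> u v v' s gs.
  have [->|u0] := eqVneq u 0%R; first by rewrite !a0l.
  have [->|v0] := eqVneq v 0%R; first by rewrite add0r a0r.
  have [->|v'0] := eqVneq v' 0%R; first by rewrite addr0 a0r.
  have [a <-] := lab_onto labI u0; have [b eb] := lab_onto labJ v0.
  have [b' eb'] := lab_onto labJ v'0; subst v v'.
  have [<-|ne] := eqVneq b b'; first by rewrite W2 a0r !actE TT.
  have [c ec] : exists c, nu c = (nu b' + nu b)%R.
    apply: (lab_onto labJ); rewrite addr_eq0 mxF2_opp (inj_eq (lab_inj labJ)).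
    by rewrite eq_sym.
  rewrite addrC -ec !actE.
  have [e1 g1 s1] := TP a b' s gs; have [e2 g2 s2] := TP a b _ g1.
  have [e3 g3 s3] := TP a c s gs; rewrite e1 in s2.
  apply: state_eq; last first.
    move=> i j; have nb : b' != b by rewrite eq_sym.
    exact: (step_add W2 V2 (locally_grid_flip lg) labJ labI (good_flip gs) nb ec
             (step_flip s1) (step_flip s2) (step_flip s3) j i).
  rewrite e2 e3; case: s1 => _ _ _ -> //.
  by rewrite (twistP W2 labJ (k := c)).
- by move=> a b s gs; rewrite actE; have [] := TP a b s gs.
Qed.

Lemma bilinear_cover (x0 : G) (f0 : I -> J -> G) : connected G -> good mu nu x0 f0 ->
  covered_by G (Bil2 d e).
Proof.
move=> Gconn g0.
have [T [TP [T0l T0r] TDl TDr base]] := action_exists.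
pose s0 : state := (x0, [ffun u => f0 u.1 u.2]).
have gs0 : good_state s0 by rewrite /good_state chart_ffun.
pose D (A : Bil2 d e) := develop T (index_enum 'I_d) A s0.
have gD A : good_state (D A) by apply: (develop_P TP).
have fD A : frame (D A).1 (chart (D A)) by case: (gD A).
have stepD (A : Bil2 d e) a b : (D (A + (mu a)^T *m nu b)%R).1 = chart (D A) a b.
  by rewrite /D (develop_step TP T0l T0r TDl TDr) // base; [|exact: gD].
have nbr (A B : Bil2 d e) : adj A B -> exists a b, B = (A + (mu a)^T *m nu b)%R.
  move=> /eqP /rank1_factor[u [v [u0 v0 E]]].
  have [a ea] := lab_onto labI u0; have [b eb] := lab_onto labJ v0.
  by exists a, b; rewrite ea eb -E addrA mxF2_double add0r mxF2_opp.
have adjD (A : Bil2 d e) a b : adj A (A + (mu a)^T *m nu b : Bil2 d e)%R.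
  rewrite /= /bil2_adj opprD addrA subrr add0r mxrank_opp.
  by rewrite rank_rank1 ?lab_neq0.
exists (fun A => (D A).1); split.
- have reach (y : G) (p : seq G) (A : Bil2 d e) : path (@adj G) (D A).1 p ->
      exists B : Bil2 d e, (D B).1 = last (D A).1 p.
    elim: p A => [|z p IH] A /=; first by exists A.
    case/andP=> /(frame_ex (fD A))[a [b ->]]; rewrite -stepD => /IH //.
  move=> y; have /connectP[p] := Gconn (D 0%R).1 y.
  by move/(reach y) => [B EB] ->; exists B.
- by move=> A B /nbr[a [b ->]]; rewrite stepD (frame_adj _ _ (fD A)).
- move=> A B C; rewrite !inE => /nbr[a [b ->]] /nbr[a' [b' ->]]; rewrite !stepD.
  by move/eqP; rewrite (frame_eq _ _ _ _ (fD A)) => /andP[/eqP-> /eqP->].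
- move=> A; apply/setP => y; rewrite inE; apply/imsetP/idP => [[B]|/(frame_ex (fD A))[a [b ->]]].
    by rewrite inE => /nbr[a [b ->]] ->; rewrite stepD (frame_adj _ _ (fD A)).
  by exists (A + (mu a)^T *m nu b)%R; rewrite ?inE ?adjD ?stepD.
Qed.

End Cover.

Definition walk (G : sgraph) (x y : G) k :=
  [exists p : k.-tuple G, path (@adj G) x p && (last x p == y)].

Lemma walk0 (G : sgraph) (x y : G) : walk x y 0 = (x == y).
Proof.
apply/existsP/idP => [[p]|xy]; first by rewrite tuple0.
by exists [tuple]; rewrite /= xy.
Qed.

Lemma walk1 (G : sgraph) (x y : G) : walk x y 1 = adj x y.
Proof.
apply/existsP/idP => [[p]|xy].
  by case/tupleP: p => z p; rewrite tuple0 /= andbT => /andP[? /eqP<-].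
by exists [tuple y]; rewrite /= xy eqxx.
Qed.

Lemma walk2 (G : sgraph) (x y : G) : walk x y 2 = [exists v, adj x v && adj y v].
Proof.
apply/existsP/existsP => [[p]|[v /andP[xv yv]]].
  case/tupleP: p => z p; case/tupleP: p => t p; rewrite tuple0 /= andbT.
  by case/andP=> /andP[xz zt] /eqP<-; exists z; rewrite xz adj_sym.
by exists [tuple v; y]; rewrite /= xv adj_sym yv eqxx.
Qed.

Lemma at2_dist (G : sgraph) (x y : G) : at2 x y -> dist x y = 2.
Proof.
case/and3P=> nxy axy ex; have /existsP[v /andP[xv yv]] := ex.
have : 2 < #|G|.
  apply/card_gt2P; exists x, y, v; split; split=> //.
  - by apply: contraNneq axy => ->.
  - by apply: contraNneq axy => <-; rewrite adj_sym.
rewrite /dist; case: #|G| => [|[|[|N]]] // _ /=.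
by rewrite -!/(walk _ _ _) walk0 walk1 walk2 (negPf nxy) (negPf axy) ex.
Qed.

Lemma dist3_beyond2 (G : sgraph) (x y : G) : dist x y = 3 -> beyond2 x y.
Proof.
move=> E; have G3 : 3 <= #|G|.
  by rewrite -E /dist -[X in _ <= X](size_iota 0); apply: find_size.
have no k : k < 3 -> walk x y k = false.
  move=> k3; have := @before_find _ 0 (walk x y) (iota 0 #|G|) k.
  rewrite nth_iota ?add0n; last exact: leq_trans k3 G3.
  by apply; rewrite -[find _ _]/(dist x y) E.
by rewrite /beyond2 -walk0 -walk1 -walk2 !no.
Qed.

Lemma graph_iso_frame (G : sgraph) n m (x : G) : graph_iso (local_graph x) (grid n m) ->
  exists f : 'I_n -> 'I_m -> G, frame x f.
Proof.
case=> h [h' hK h'K] hadj.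
have nbr v : (v \in sphere 1 x) = adj x v by rewrite sphere1E inE.
exists (fun i j => val (h' (i, j))); split.
- by move=> i j; rewrite -nbr; exact: valP.
- move=> v xv; have vS : v \in sphere 1 x by rewrite nbr.
  exists (h (Sub v vS)).1, (h (Sub v vS)).2.
  by rewrite -surjective_pairing hK SubK.
- by move=> i j i' j'; rewrite (inj_eq val_inj) (inj_eq (can_inj h'K)).
- move=> i j i' j'; rewrite -[LHS]/(adj (h' (i, j)) (h' (i', j'))) -hadj !h'K /=.
  rewrite /cart_adj /= /complete_adj.
  by case: (i == i'); case: (j == j').
Qed.

Lemma locally_grid_intersection (G : sgraph) n m :
    2 < n -> 2 < m -> b_well_defined G 2 ((n - 3) * (m - 3)) -> c_well_defined G 2 6 ->
    (forall x : G, graph_iso (local_graph x) (grid n m)) ->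
  locally_grid G 'I_n 'I_m.
Proof.
move=> hn hm hb2 hc2 hloc; split; rewrite ?card_ord //.
- by move=> x; apply: graph_iso_frame.
- move=> x y /at2_dist/hc2 <-; rewrite /c_num /= !sphere1E.
  by apply: eq_card => v; rewrite !inE andbC.
- move=> x y /at2_dist/hb2 <-; rewrite /b_num; apply: subset_leq_card.
  apply/subsetP => w; rewrite sphere1E !inE => /andP[-> /eqP/dist3_beyond2->] //.
Qed.

Lemma locally_grid_cover (G : sgraph) (I J : finType) (x : G) :
    connected G -> locally_grid G I J ->
  exists d e, [/\ #|I|.+1 = 2 ^ d, #|J|.+1 = 2 ^ e & covered_by G (Bil2 d e)].
Proof.
move=> Gconn lg; have [f xf] := lg_frame lg x.
have [d [mu [labI hI]]] := tri_labelling lg xf.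
have [e [nu [labJ hJ]]] := tri_labelling (locally_grid_flip lg) (frame_flip xf).
exists d, e; split; [exact: labelling_card labI|exact: labelling_card labJ|].
by apply: (bilinear_cover lg labI labJ (x0 := x) (f0 := f)).
Qed.

Theorem theorem1p2 (n m : nat) (hn : 3 <= n) (hm : 3 <= m)
    (Gamma : sgraph) (hconn : connected Gamma)
    (hdiam : 2 <= diameter Gamma)
    (hb0 : b_well_defined Gamma 0 (n * m))
    (hb1 : b_well_defined Gamma 1 ((n - 1) * (m - 1)))
    (hb2 : b_well_defined Gamma 2 ((n - 3) * (m - 3)))
    (hc2 : c_well_defined Gamma 2 6)
    (hloc : forall x : Gamma, graph_iso (local_graph x) (grid n m)) :
  exists d e : nat,
    [/\ 2 <= d <= e,
        minn m n = 2 ^ d - 1,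
        maxn m n = 2 ^ e - 1
      & covered_by Gamma (Bil2 d e)].
Proof.
have lg := locally_grid_intersection hn hm hb2 hc2 hloc.
have [x _] : exists x : Gamma, True.
  case: (pickP (pred_of_simpl (@predT Gamma))) => [x _|no]; first by exists x.
  by move: hdiam; rewrite /diameter big_pred0.
suff [k [l [kl k3 [E1 E2 lg']]]] : exists k l, [/\ k <= l, 3 <= k
    & [/\ minn m n = k, maxn m n = l & locally_grid Gamma 'I_k 'I_l]].
  have [d [e [Ed Ee cov]]] := locally_grid_cover x hconn lg'.
  rewrite !card_ord in Ed Ee.
  exists d, e; rewrite E1 E2 -Ed -Ee !subn1; split=> //; apply/andP; split.
    by rewrite -(leq_exp2l (m := 2)) // -Ed.
  by rewrite -(leq_exp2l (m := 2)) // -Ed -Ee.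
case: (leqP n m) => [nm|/ltnW mn].
- by exists n, m; split=> //; split.
- by exists m, n; split=> //; split; last exact: locally_grid_flip.
Qed.
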